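(* Let $\mathcal{C}$ be an integral fusion category over $\mathbb{C}$ with commutative Grothendieck ring, equipped with its canonical spherical structure, and suppose that all the structure constants $c^k_{ij}$ of $\mathcal{C}$ (defined by $\mathrm{C}_i\mathrm{C}_j=\sum_{k=0}^m c^k_{ij}\mathrm{C}_k$, where the $\mathrm{C}_j$ are the conjugacy class sums) are rational numbers. Then for every $\sigma\in\mathrm{Gal}(\mathbb{K}/\mathbb{Q})$ the linear map $\sigma_E:\mathrm{CE}(\mathcal{C})\to\mathrm{CE}(\mathcal{C})$ is an algebra map. Moreover, for every such $\sigma$ there is a permutation $\eta=\eta_\sigma$ of $\{0,\dots,m\}$ such that $$\sigma_F(\chi_i)=\chi_{\eta(i)},\qquad \sigma_E(E_i)=E_{\eta^{-1}(i)}$$ for all $i\in\{0,\dots,m\}$.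
   Context: A fusion category is integral if $\mathrm{FPdim}(X)\in\mathbb{Z}_{>0}$ for every simple $X$. Such a category has a canonical spherical structure, for which quantum dimensions equal Frobenius–Perron dimensions; this one is used. Let $M_0=\mathbf{1},M_1,\dots,M_m$ be representatives of the simple objects, $d_i=\dim(M_i)$, $M_i^*\simeq M_{i^*}$, and $\dim(\mathcal{C})=\sum_i d_id_{i^*}$. Let $F:\mathcal{Z}(\mathcal{C})\to\mathcal{C}$ be the forgetful functor from the Drinfeld center, $R$ its right adjoint, and $A=FR(\mathbf{1})\simeq\bigoplus_i M_i\otimes M_i^*$ the adjoint algebra. Put $\mathrm{CF}(\mathcal{C})=\mathrm{Hom}_{\mathcal{C}}(A,\mathbf{1})$ (class functions), identified as a $\mathbb{C}$-algebra with $\mathrm{Gr}(\mathcal{C})\otimes_{\mathbb{Z}}\mathbb{C}$ via internal characters; $\chi_i$ is the internal character of $M_i$ and corresponds to $[M_i]$; explicitly $\chi_i:A\to M_i\otimes M_i^*\to\mathbf{1}$ is projection followed by right evaluation. Put $\mathrm{CE}(\mathcal{C})=\mathrm{Hom}_{\mathcal{C}}(\mathbf{1},A)$ (central elements), a $\mathbb{C}$-algebra with $a\cdot b=m_A\circ(a\otimes b)$; its primitive idempotents are $E_i:\mathbf{1}\xrightarrow{\mathrm{coev}}M_i\otimes M_i^*\hookrightarrow A$. There is a non-degenerate pairing $\mathrm{CF}(\mathcal{C})\times\mathrm{CE}(\mathcal{C})\to\mathbb{C}$, $\langle f,a\rangle\,\mathrm{id}_{\mathbf{1}}=f\circ a$.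 Since $\mathrm{CF}(\mathcal{C})$ is commutative and semisimple, let $F_0,\dots,F_m$ be its primitive idempotents and $\mu_0,\dots,\mu_m:\mathrm{CF}(\mathcal{C})\to\mathbb{C}$ the algebra morphisms with $\mu_i(F_j)=\delta_{i,j}$, numbered so that $\mu_0(\chi_i)=d_i$. Put $\alpha_{ij}=\mu_j(\chi_i)$, so $\chi_i=\sum_j\alpha_{ij}F_j$. The field $\mathbb{K}=\mathbb{Q}(\alpha_{ij}: i,j)$ is contained in a cyclotomic field. One has $R(\mathbf{1})=\bigoplus_{j=0}^m\mathcal{C}^j$ with $\mathcal{C}^j$ pairwise non-isomorphic simple objects of $\mathcal{Z}(\mathcal{C})$ (conjugacy classes), $\mathcal{C}^j$ corresponding to $F_j$ under the canonical isomorphism $\mathrm{End}_{\mathcal{Z}(\mathcal{C})}(R(\mathbf{1}))\simeq\mathrm{CF}(\mathcal{C})$. The class sum $\mathrm{C}_j\in\mathrm{CE}(\mathcal{C})$ is the inverse Fourier transform of $F_j$ (with respect to the cointegral $F_0$); equivalently it is the unique element with $\langle\chi_i,\mathrm{C}_j\rangle=\dim(\mathcal{C}^j)\alpha_{ij}$ for all $i$. The $\mathrm{C}_j$ form a basis of $\mathrm{CE}(\mathcal{C})$. For $\sigma\in\mathrm{Gal}(\mathbb{K}/\mathbb{Q})$ the linear functional $\chi_i\mapsto\sigma(\alpha_{ij})$ on $\mathrm{CF}(\mathcal{C})$ is an algebra morphism, hence equals $\mu_{\tau(j)}$ for a unique index $\tau(j)=\tau_\sigma(j)$; thus $\sigma(\alpha_{ij})=\alpha_{i\tau(j)}$.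 Define $\mathbb{C}$-linear maps $\sigma_F:\mathrm{CF}(\mathcal{C})\to\mathrm{CF}(\mathcal{C})$ by $\sigma_F(\chi_i)=\sum_j\sigma(\alpha_{ij})F_j$ and $\sigma_E:\mathrm{CE}(\mathcal{C})\to\mathrm{CE}(\mathcal{C})$ by $\sigma_E\big(\mathrm{C}_j/\dim(\mathcal{C}^j)\big)=\mathrm{C}_{\tau(j)}/\dim(\mathcal{C}^{\tau(j)})$. *)

(* Defs.v *)
From HB Require Import structures.
From mathcomp Require Import all_boot all_order all_algebra.
From mathcomp Require Import all_fingroup.
From mathcomp Require Import boolp classical_sets functions reals.
From mathcomp Require Export complex.

Set Implicit Arguments.
Unset Strict Implicit.
Unset Printing Implicit Defensive.
Import Order.TTheory GRing.Theory Num.Theory.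

Local Open Scope ring_scope.

Record linCat (k : fieldType) := LinCat {
  obj :> Type;
  mor : obj -> obj -> vectType k;
  idm : forall X, mor X X;
  compm : forall X Y Z, mor Y Z -> mor X Y -> mor X Z;
  comp_linear_l : forall X Y Z (f : mor X Y), linear (fun g => @compm X Y Z g f);
  comp_linear_r : forall X Y Z (g : mor Y Z), linear (fun f => @compm X Y Z g f);
  compA : forall W X Y Z (h : mor Y Z) (g : mor X Y) (f : mor W X),
    compm h (compm g f) = compm (compm h g) f;
  comp1m : forall X Y (f : mor X Y), compm (idm Y) f = f;
  compm1 : forall X Y (f : mor X Y), compm f (idm X) = f
}.

Arguments mor {k C} X Y : rename.
Arguments idm {k C} X : rename.
Arguments compm {k C X Y Z} g f : rename.

Notation "g \c f" := (compm g f) (at level 40, left associativity).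

Section LinearCategory.
Variables (k : fieldType) (C : linCat k).
Implicit Types X Y Z W : C.

Definition is_mono X Y (f : mor X Y) :=
  forall W (g h : mor W X), f \c g = f \c h -> g = h.

Definition is_epi X Y (f : mor X Y) :=
  forall W (g h : mor Y W), g \c f = h \c f -> g = h.

Definition is_iso X Y (f : mor X Y) :=
  exists g : mor Y X, g \c f = idm X /\ f \c g = idm Y.

Definition isomorphic X Y := exists f : mor X Y, is_iso f.

Definition is_biproduct (n : nat) (S : 'I_n -> C) X
    (i : forall j, mor (S j) X) (p : forall j, mor X (S j)) :=
  [/\ forall j, p j \c i j = idm (S j),
      forall j l, j != l -> p l \c i j = 0
    & \sum_j i j \c p j = idm X].

Definition is_kernel K X Y (u : mor K X) (f : mor X Y) :=
  f \c u = 0 /\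
  forall W (g : mor W X), f \c g = 0 -> exists! h : mor W K, u \c h = g.

Definition is_cokernel X Y Q (u : mor Y Q) (f : mor X Y) :=
  u \c f = 0 /\
  forall W (g : mor Y W), g \c f = 0 -> exists! h : mor Q W, h \c u = g.

(* The case [n = 0] of the first clause provides a zero object. *)
Definition is_abelian :=
  [/\ forall (n : nat) (S : 'I_n -> C), exists X i p, @is_biproduct n S X i p,
      forall X Y (f : mor X Y), exists K (u : mor K X), is_kernel u f,
      forall X Y (f : mor X Y), exists Q (u : mor Y Q), is_cokernel u f,
      forall X Y (f : mor X Y), is_mono f ->
        exists Z (g : mor Y Z), is_kernel f g
    & forall X Y (f : mor X Y), is_epi f ->
        exists Z (g : mor Z X), is_cokernel f g].

(* The source of a monomorphism [f] is a zero object exactly when [f = 0]. *)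
Definition is_simple X :=
  idm X <> 0 /\
  forall Y (f : mor Y X), is_mono f -> f = 0 \/ is_iso f.

Definition is_semisimple :=
  forall X, exists n (S : 'I_n -> C) i p,
    (forall j, is_simple (S j)) /\ @is_biproduct n S X i p.

Definition simple_representatives (n : nat) (M : 'I_n -> C) :=
  [/\ forall i, is_simple (M i),
      forall i j, isomorphic (M i) (M j) -> i = j
    & forall X, is_simple X -> exists i, isomorphic X (M i)].

End LinearCategory.

Record tensorCat (k : fieldType) := TensorCat {
  tcat :> linCat k;
  tone : tcat;
  ten : tcat -> tcat -> tcat;
  tenm : forall X Y X' Y' : tcat,
    mor X X' -> mor Y Y' -> mor (ten X Y) (ten X' Y');
  tenm_linear_l : forall (X Y X' Y' : tcat) (g : mor Y Y'),
    linear (fun f : mor X X' => tenm f g);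
  tenm_linear_r : forall (X Y X' Y' : tcat) (f : mor X X'),
    linear (fun g : mor Y Y' => tenm f g);
  tenm1 : forall X Y : tcat, tenm (idm X) (idm Y) = idm (ten X Y);
  tenm_comp : forall (X Y X' Y' X'' Y'' : tcat) (f' : mor X' X'')
      (f : mor X X') (g' : mor Y' Y'') (g : mor Y Y'),
    tenm (f' \c f) (g' \c g) = tenm f' g' \c tenm f g;

  ass : forall X Y Z : tcat, mor (ten (ten X Y) Z) (ten X (ten Y Z));
  assV : forall X Y Z : tcat, mor (ten X (ten Y Z)) (ten (ten X Y) Z);
  assK : forall X Y Z : tcat, assV X Y Z \c ass X Y Z = idm _;
  assVK : forall X Y Z : tcat, ass X Y Z \c assV X Y Z = idm _;
  ass_nat : forall (X Y Z X' Y' Z' : tcat)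
      (f : mor X X') (g : mor Y Y') (h : mor Z Z'),
    ass X' Y' Z' \c tenm (tenm f g) h = tenm f (tenm g h) \c ass X Y Z;

  lun : forall X : tcat, mor (ten tone X) X;
  lunV : forall X : tcat, mor X (ten tone X);
  lunK : forall X : tcat, lunV X \c lun X = idm _;
  lunVK : forall X : tcat, lun X \c lunV X = idm _;
  lun_nat : forall (X X' : tcat) (f : mor X X'),
    lun X' \c tenm (idm tone) f = f \c lun X;

  run : forall X : tcat, mor (ten X tone) X;
  runV : forall X : tcat, mor X (ten X tone);
  runK : forall X : tcat, runV X \c run X = idm _;
  runVK : forall X : tcat, run X \c runV X = idm _;
  run_nat : forall (X X' : tcat) (f : mor X X'),
    run X' \c tenm f (idm tone) = f \c run X;

  pentagon : forall W X Y Z : tcat,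
    ass W X (ten Y Z) \c ass (ten W X) Y Z =
    tenm (idm W) (ass X Y Z) \c ass W (ten X Y) Z \c tenm (ass W X Y) (idm Z);
  triangle : forall X Y : tcat,
    tenm (idm X) (lun Y) \c ass X tone Y = tenm (run X) (idm Y);

  ldual : tcat -> tcat;
  ev : forall X : tcat, mor (ten (ldual X) X) tone;
  coev : forall X : tcat, mor tone (ten X (ldual X));
  dual_zigzag : forall X : tcat,
    run X \c tenm (idm X) (ev X) \c ass X (ldual X) X
      \c tenm (coev X) (idm X) \c lunV X = idm X;
  dual_zigzagV : forall X : tcat,
    lun (ldual X) \c tenm (ev X) (idm (ldual X)) \c assV (ldual X) X (ldual X)
      \c tenm (idm (ldual X)) (coev X) \c runV (ldual X) = idm (ldual X)
}.

Arguments tone {k} t.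
Arguments ten {k t} X Y.
Arguments tenm {k t X Y X' Y'} f g.
Arguments ass {k t} X Y Z.
Arguments assV {k t} X Y Z.
Arguments lun {k t} X.
Arguments lunV {k t} X.
Arguments run {k t} X.
Arguments runV {k t} X.
Arguments ldual {k t} X.
Arguments ev {k t} X.
Arguments coev {k t} X.

Notation "X \ox Y" := (ten X Y) (at level 35, right associativity).
Notation "f \om g" := (tenm f g) (at level 35, right associativity).

Section TensorCategory.
Variables (k : fieldType) (C : tensorCat k).
Implicit Types X Y Z W : C.

Definition has_right_duals :=
  forall X, exists (Y : C) (e : mor (X \ox Y) (tone C))
      (c : mor (tone C) (Y \ox X)),
    lun X \c (e \om idm X) \c assV X Y X \c (idm X \om c) \c runV X = idm X /\
    run Y \c (idm Y \om e) \c ass Y X Y \c (c \om idm Y) \c lunV Y = idm Y.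

(* Finiteness of the set of simple objects is part of
   [simple_representatives], whose indexing type is finite. *)
Definition is_fusion (n : nat) (M : 'I_n -> C) :=
  [/\ is_abelian C, is_semisimple C, has_right_duals,
      \dim {: mor (tone C) (tone C)} = 1%N & simple_representatives M].

(* The scalar [c] such that [f = c *: idm 1], when [End(1)] is a line. *)
Definition scal (f : mor (tone C) (tone C)) : k :=
  coord [tuple idm (tone C)] ord0 f.

(* The transpose [Z -> ldual X] of [e]. *)
Definition mate Z X (e : mor (Z \ox X) (tone C)) : mor Z (ldual X) :=
  lun (ldual X) \c (e \om idm (ldual X)) \c assV Z X (ldual X)
    \c (idm Z \om coev X) \c runV Z.

Definition dualm X Y (f : mor X Y) : mor (ldual Y) (ldual X) :=
  mate (ev Y \c (idm (ldual Y) \om f)).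

Definition dual_ten X Y : mor (ldual Y \ox ldual X) (ldual (X \ox Y)) :=
  mate (ev Y \c (idm (ldual Y) \om lun Y)
        \c (idm (ldual Y) \om (ev X \om idm Y))
        \c (idm (ldual Y) \om assV (ldual X) X Y)
        \c ass (ldual Y) (ldual X) (X \ox Y)).

(* A pivotal structure: a monoidal natural isomorphism from the identity to the
   double dual.  Both sides of the monoidality condition are morphisms
   X \ox Y -> ldual (ldual Y \ox ldual X). *)
Record pivotal := Pivotal {
  piv :> forall X, mor X (ldual (ldual X));
  piv_iso : forall X, is_iso (piv X);
  piv_nat : forall X Y (f : mor X Y),
    piv Y \c f = dualm (dualm f) \c piv X;
  piv_monoidal : forall X Y,
    dualm (dual_ten X Y) \c piv (X \ox Y) =
    dual_ten (ldual Y) (ldual X) \c (piv X \om piv Y)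
}.

Definition right_ev (a : pivotal) X : mor (X \ox ldual X) (tone C) :=
  ev (ldual X) \c (a X \om idm (ldual X)).

Definition qdim (a : pivotal) X : k := scal (right_ev a X \c coev X).

Definition is_spherical (a : pivotal) := forall X, qdim a X = qdim a (ldual X).

Section Grothendieck.
Variables (n : nat) (M : 'I_n -> C).

(* [fusion_coef X j l] is the multiplicity of [M l] in [X \ox M j]. *)
Definition fusion_coef X (j l : 'I_n) : nat :=
  \dim {: mor (M l) (X \ox M j)}.

Definition Gr_commutative :=
  forall i j l, fusion_coef (M i) j l = fusion_coef (M j) i l.

Definition fusion_mx X : 'M[k]_n := \matrix_(j, l) (fusion_coef X j l)%:R.

End Grothendieck.
End TensorCategory.

(* [x] is the largest nonnegative real eigenvalue of multiplication by [X] on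
   the Grothendieck ring; in a numClosedFieldType, [0 <= y] means that [y] is
   real and nonnegative. *)
Definition is_FPdim (k : numClosedFieldType) (C : tensorCat k) (n : nat)
    (M : 'I_n -> C) (X : C) (x : k) :=
  [/\ 0 <= x, eigenvalue (fusion_mx M X) x
    & forall y, 0 <= y -> eigenvalue (fusion_mx M X) y -> y <= x].

Definition is_integral (k : numClosedFieldType) (C : tensorCat k) (n : nat)
    (M : 'I_n -> C) :=
  forall X : C, is_simple X -> exists2 d : nat, (0 < d)%N & is_FPdim M X d%:R.

(* The canonical spherical structure of a (pseudo-unitary) fusion category. *)
Definition is_canonical_spherical (k : numClosedFieldType) (C : tensorCat k)
    (n : nat) (M : 'I_n -> C) (a : pivotal C) :=
  is_spherical a /\ forall X : C, is_simple X -> is_FPdim M X (qdim a X).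

Lemma ex_vspace (k : fieldType) (V : vectType k) (P : V -> Prop) :
  P 0 -> (forall (c : k) u v, P u -> P v -> P (c *: u + v)) ->
  exists U : {vspace V}, forall v, v \in U <-> P v.
Proof.
move=> P0 PL.
pose Q n := `[< exists2 U : {vspace V}, \dim U = n & forall v, v \in U -> P v >].
have exQ : exists n, Q n.
  exists 0%N; apply/asboolP; exists 0%VS; first exact: dimv0.
  by move=> v; rewrite memv0 => /eqP ->.
have Qle n : Q n -> (n <= \dim {:V})%N.
  by case/asboolP=> U <- _; rewrite dimvS ?subvf.
case: (ex_maxnP exQ Qle) => n /asboolP[U dimU UP] max_n.
exists U => v; split; first exact: UP.
move=> Pv; apply: contrapT => /negP vU.
have : Q (\dim (U + <[v]>)%VS).
  apply/asboolP; exists (U + <[v]>)%VS => // w /memv_addP[u uU [_ /vlineP[c ->] ->]].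
  by rewrite addrC; apply: PL => //; apply: UP.
move/max_n; rewrite -dimU leqNgt => /negP; apply.
rewrite ltn_neqAle (dimvS (addvSl _ _)) andbT; apply: contra vU => /eqP e.
have -> : U = (U + <[v]>)%VS.
  by apply/eqP; rewrite -(geq_leqif (dimv_leqif_eq (addvSl U <[v]>))) e.
exact: subvP (addvSr _ _) _ (memv_line v).
Qed.

Section Center.
Variables (k : fieldType) (C : tensorCat k).
Implicit Types X Y V W : C.

Record centerObj := CenterObj {
  cobj :> C;
  hbr : forall X, mor (cobj \ox X) (X \ox cobj);
  hbr_iso : forall X, is_iso (hbr X);
  hbr_nat : forall X Y (f : mor X Y),
    hbr Y \c (idm cobj \om f) = (f \om idm cobj) \c hbr X;
  hbr_ten : forall X Y,
    ass X Y cobj \c hbr (X \ox Y) \c ass cobj X Y =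
    (idm X \om hbr Y) \c ass X cobj Y \c (hbr X \om idm Y)
}.

(* [s] and [t] need not be half-braidings, so that [is_central] applies to
   [hbr_tensor] below. *)
Definition is_central V W (s : forall X, mor (V \ox X) (X \ox V))
    (t : forall X, mor (W \ox X) (X \ox W)) (f : mor V W) :=
  forall X, (idm X \om f) \c s X = t X \c (f \om idm X).

Definition hbr_one X : mor (tone C \ox X) (X \ox tone C) := runV X \c lun X.

Definition hbr_tensor V W (s : forall X, mor (V \ox X) (X \ox V))
    (t : forall X, mor (W \ox X) (X \ox W)) X :
    mor ((V \ox W) \ox X) (X \ox (V \ox W)) :=
  ass X V W \c (s X \om idm W) \c assV V X W \c (idm V \om t X) \c ass V W X.

Lemma compDl X Y Z (f f' : mor Y Z) (g : mor X Y) c :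
  (c *: f + f') \c g = c *: (f \c g) + f' \c g.
Proof. exact: (comp_linear_l g). Qed.

Lemma compDr X Y Z (f : mor Y Z) (g g' : mor X Y) c :
  f \c (c *: g + g') = c *: (f \c g) + f \c g'.
Proof. exact: (comp_linear_r f). Qed.

Lemma tenmDl X Y X' Y' (f f' : mor X X') (g : mor Y Y') c :
  (c *: f + f') \om g = c *: (f \om g) + f' \om g.
Proof. exact: (tenm_linear_l g). Qed.

Lemma tenmDr X Y X' Y' (f : mor X X') (g g' : mor Y Y') c :
  f \om (c *: g + g') = c *: (f \om g) + f \om g'.
Proof. exact: (tenm_linear_r f). Qed.

Lemma is_central0 (V W : centerObj) : is_central (hbr V) (hbr W) 0.
Proof.
move=> X.
have l0 : idm X \om (0 : mor V W) = 0.
  by have := tenmDr (idm X) (0 : mor V W) 0 (-1); rewrite scaler0 addr0 scaleN1r addNr.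
have r0 : (0 : mor V W) \om idm X = 0.
  by have := tenmDl (0 : mor V W) 0 (idm X) (-1); rewrite scaler0 addr0 scaleN1r addNr.
rewrite l0 r0.
have -> : (0 : mor (X \ox V) (X \ox W)) \c hbr V X = 0.
  by have := compDl (0 : mor (X \ox V) (X \ox W)) 0 (hbr V X) (-1);
     rewrite scaler0 addr0 scaleN1r addNr.
by have := compDr (hbr W X) (0 : mor (V \ox X) (W \ox X)) 0 (-1);
   rewrite scaler0 addr0 scaleN1r addNr.
Qed.

Lemma is_centralD (V W : centerObj) c (f g : mor V W) :
  is_central (hbr V) (hbr W) f -> is_central (hbr V) (hbr W) g ->
  is_central (hbr V) (hbr W) (c *: f + g).
Proof.
by move=> cf cg X; rewrite tenmDr tenmDl compDl compDr cf cg.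
Qed.

Lemma is_central1 (V : centerObj) : is_central (hbr V) (hbr V) (idm V).
Proof. by move=> X; rewrite !tenm1 comp1m compm1. Qed.

Lemma is_central_comp (U V W : centerObj) (g : mor V W) (f : mor U V) :
  is_central (hbr V) (hbr W) g -> is_central (hbr U) (hbr V) f ->
  is_central (hbr U) (hbr W) (g \c f).
Proof.
move=> cg cf X.
rewrite -[in LHS](comp1m (idm X)) tenm_comp -compA cf compA cg.
by rewrite -compA -tenm_comp comp1m.
Qed.

Definition center_vs (V W : centerObj) : {vspace mor V W} :=
  sval (cid (ex_vspace (is_central0 V W) (@is_centralD V W))).

Lemma center_vsP (V W : centerObj) (f : mor V W) :
  f \in center_vs V W <-> is_central (hbr V) (hbr W) f.
Proof. exact: (svalP (cid (ex_vspace (is_central0 V W) (@is_centralD V W)))). Qed.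

Definition center_hom (V W : centerObj) : vectType k := subvs_of (center_vs V W).

Definition center_id (V : centerObj) : center_hom V V :=
  vsproj (center_vs V V) (idm V).

Definition center_comp (U V W : centerObj) (g : center_hom V W)
    (f : center_hom U V) : center_hom U W :=
  vsproj (center_vs U W) (vsval g \c vsval f).

Lemma center_homP (V W : centerObj) (f : center_hom V W) :
  is_central (hbr V) (hbr W) (vsval f).
Proof. exact/center_vsP/subvsP. Qed.

Lemma center_idE (V : centerObj) : vsval (center_id V) = idm V.
Proof. exact/vsprojK/center_vsP/is_central1. Qed.

Lemma center_compE (U V W : centerObj) (g : center_hom V W) (f : center_hom U V) :
  vsval (center_comp g f) = vsval g \c vsval f.
Proof. by apply/vsprojK/center_vsP/is_central_comp; exact: center_homP. Qed.

Lemma center_comp_linear_l (U V W : centerObj) (f : center_hom U V) :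
  linear (fun g : center_hom V W => center_comp g f).
Proof.
move=> c g h; apply: subvs_inj.
by rewrite center_compE [vsval (_ + _)]linearP compDl [RHS]linearP /= !center_compE.
Qed.

Lemma center_comp_linear_r (U V W : centerObj) (g : center_hom V W) :
  linear (fun f : center_hom U V => center_comp g f).
Proof.
move=> c f h; apply: subvs_inj.
by rewrite center_compE [vsval (_ + _)]linearP compDr [RHS]linearP /= !center_compE.
Qed.

Lemma center_compA (T U V W : centerObj) (h : center_hom V W)
    (g : center_hom U V) (f : center_hom T U) :
  center_comp h (center_comp g f) = center_comp (center_comp h g) f.
Proof. by apply: subvs_inj; rewrite !center_compE compA. Qed.

Lemma center_comp1m (V W : centerObj) (f : center_hom V W) :
  center_comp (center_id W) f = f.
Proof. by apply: subvs_inj; rewrite center_compE center_idE comp1m. Qed.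

Lemma center_compm1 (V W : centerObj) (f : center_hom V W) :
  center_comp f (center_id V) = f.
Proof. by apply: subvs_inj; rewrite center_compE center_idE compm1. Qed.

Definition drinfeld_center : linCat k :=
  LinCat center_comp_linear_l center_comp_linear_r center_compA
    center_comp1m center_compm1.

Definition forget (V W : drinfeld_center) (f : mor V W) :
    mor (cobj V) (cobj W) := vsval f.

(* The value R(1) of the right adjoint of the forgetful functor, with the
   counit of the adjunction and the algebra structure coming from the lax
   monoidal structure of R: [amul] and [aunit] are the morphisms of Z(C)
   adjunct to [counit \om counit] and to the identity of the unit object. *)
Record adjointAlg := AdjointAlg {
  radj : drinfeld_center;
  counit : mor (cobj radj) (tone C);
  counit_univ : forall (V : drinfeld_center) (f : mor (cobj V) (tone C)),
    exists! g : mor V radj, counit \c forget g = f;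
  amul : mor (cobj radj \ox cobj radj) (cobj radj);
  amul_central :
    is_central (hbr_tensor (hbr radj) (hbr radj)) (hbr radj) amul;
  amul_counit : counit \c amul = lun (tone C) \c (counit \om counit);
  aunit : mor (tone C) (cobj radj);
  aunit_central : is_central hbr_one (hbr radj) aunit;
  aunit_counit : counit \c aunit = idm (tone C)
}.

Variable A : adjointAlg.

Definition adj : C := cobj (radj A).

Definition CF : vectType k := mor adj (tone C).
Definition CE : vectType k := mor (tone C) adj.

Definition pairing (f : CF) (a : CE) : k := scal (f \c a).

(* The adjunction isomorphism End(R(1)) -> Hom(FR(1), 1). *)
Definition CF_of_End (f : mor (radj A) (radj A)) : CF := counit A \c forget f.

Definition ce_mul (a b : CE) : CE := amul A \c (a \om b) \c lunV (tone C).
Definition ce_one : CE := aunit A.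

(* The universal dinatural map A -> X \ox X^*, which for X = M_i is the
   projection onto the i-th summand of A = \bigoplus_i M_i \ox M_i^*. *)
Definition adj_proj X : mor adj (X \ox ldual X) :=
  (run X \om idm (ldual X)) \c ((idm X \om counit A) \om idm (ldual X))
    \c (hbr (radj A) X \om idm (ldual X)) \c assV adj X (ldual X)
    \c (idm adj \om coev X) \c runV adj.

Definition int_char (a : pivotal C) X : CF := right_ev a X \c adj_proj X.

(* The product of CF(C), identified with the complexified Grothendieck ring
   through the basis of internal characters, which corresponds to the basis of
   classes of simple objects. *)
Definition cf_mul (a : pivotal C) (n : nat) (M : 'I_n -> C) (f g : CF) : CF :=
  let chi := [tuple int_char a (M i) | i < n] in
  \sum_i \sum_j \sum_l
    (coord chi i f * coord chi j g * (fusion_coef M (M i) j l)%:R)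
      *: int_char a (M l).

End Center.

Arguments center_hom {k C} V W.

Section Products.
Variables (k : fieldType) (V : vectType k) (mul : V -> V -> V) (e : V).

Definition is_primitive_idempotent (f : V) :=
  [/\ f <> 0, mul f f = f
    & forall g h, mul g g = g -> mul h h = h -> mul g h = 0 -> mul h g = 0 ->
        f = g + h -> g = 0 \/ h = 0].

Definition is_character (mu : V -> k) :=
  [/\ scalar mu, mu e = 1 & forall f g, mu (mul f g) = mu f * mu g].

Definition is_algebra_endo (s : V -> V) :=
  [/\ linear s, s e = e & forall f g, s (mul f g) = mul (s f) (s g)].

End Products.

Definition generated_field (k : fieldType) (G : set k) : set k :=
  [set x | forall S : {pred k}, divring_closed S ->
             (forall y, G y -> y \in S) -> x \in S].

(* [s] restricts to a field automorphism of the subfield [K]; its values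
   outside [K] are irrelevant. *)
Definition is_field_aut (k : fieldType) (K : set k) (s : k -> k) :=
  [/\ set_bij K K s, s 1 = 1,
      forall x y, K x -> K y -> s (x + y) = s x + s y
    & forall x y, K x -> K y -> s (x * y) = s x * s y].

Section Galois.
Variables (k : fieldType) (n : nat) (alpha : 'M[k]_n) (s : k -> k).

(* The index [l] with [s (alpha i j) = alpha i l] for all [i]. *)
Definition tau (j : 'I_n) : 'I_n :=
  odflt j [pick l | [forall i, s (alpha i j) == alpha i l]].

Variables (V : vectType k).

(* The linear map sending each [chi i] to [\sum_j s (alpha i j) F j]. *)
Definition sigmaF (chi F : 'I_n -> V) (f : V) : V :=
  \sum_i coord [tuple chi i | i < n] i f *: \sum_j s (alpha i j) *: F j.

(* The linear map sending each [(d j)^-1 *: c j] to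
   [(d (tau j))^-1 *: c (tau j)]. *)
Definition sigmaE (d : 'I_n -> k) (c : 'I_n -> V) (v : V) : V :=
  let b := [tuple (d j)^-1 *: c j | j < n] in
  \sum_j coord b j v *: ((d (tau j))^-1 *: c (tau j)).

End Galois.

(* Main.v *)
From HB Require Import structures.
Require Import Defs.
From mathcomp Require Import all_boot all_order all_algebra all_fingroup.
From mathcomp Require Import boolp classical_sets functions reals.
From mathcomp Require Import ring.

(** Why the theorem is true.

    Central elements.  An element [b] of CE(C) acts on every object [X] through
    the half-braiding of the adjoint algebra, [action X b], and this action is
    multiplicative ([action_mul]).  On the simple object [M i] it is a scalar by
    Schur's lemma, [central_char i b = <chi_i, b> / d_i].  These n characters
    separate CE(C) ([central_char_inj]) and are dual to the [E i]
    ([central_char_E]), so CE(C) is k^n with idempotents [E i].  At the class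
    sums the characters take the values [omega i j = dim(C^j) alpha_ij / d_i].

    Galois action.  An algebra map k^n -> k is a coordinate ([character_row]).
    The fusion coefficients are integers, so [sigma] applied to a column of
    [alpha] is again a character of CF(C), i.e. a column: this is [tau].  The
    structure constants of the class sums are rational, so [sigma] applied to
    [omega i] is again a character of CE(C), i.e. some [omega (e i)].  Integrality
    makes all dimensions natural numbers ([qdim_nat]), hence fixed by [sigma], and
    [sigma (alpha i j) = q_i alpha (e i) j] with [q_i = d_i / d_(e i)].

    The scalars are 1.  Apply [sigma] to the fusion rules of [M i] with its dual
    and compare the coefficients of the unit object: q_i q_i' = 1, where [i'] is
    the index of the dual.  As dual objects have the same dimension, q_i = q_i',
    hence q_i^2 = 1 and q_i, a positive rational, is 1 ([galois_row_perm]).  The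
    input on fusion rules is [unit_multiplicity]: the unit occurs in [X (x) Y],
    for [X] and [Y] simple, only when [Y] is dual to [X], and then once.

    Conclusion.  With [eta = e] one has [sigmaF (chi i) = chi (eta i)], and
    [central_char i (sigmaE v) = central_char (eta i) v] for all [v], because it
    holds on class sums ([sigmaE_char]).  Since the characters separate points,
    both the multiplicativity of [sigmaE] and its value on [E i] follow.

    The categorical computations are organised around one operation, bending a
    strand with a cap and a cup ([contract_r], [contract_l]); two interchange
    laws ([contract_cup], [contract_cap]) carry all the diagrammatic arguments with
    duals. *)

Set Implicit Arguments.
Unset Strict Implicit.
Unset Printing Implicit Defensive.
Import Order.TTheory GRing.Theory Num.Theory.

Local Open Scope ring_scope.

(* Composition and identities of categories, rather than the homonymous notions
   for functions and group morphisms. *)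
Local Notation compA := Defs.compA.
Local Notation idm := Defs.idm.

(** * Linear categories and Schur's lemma *)

Section Eigenvector.
Import VectorInternalTheory.

Lemma exists_eigenvector (k : numClosedFieldType) (V : vectType k) (L : V -> V) (w : V) :
  linear L -> w <> 0 -> exists (l : k) (v : V), v <> 0 /\ L v = l *: v.
Proof.
move=> Llin w0.
pose L' : {linear V -> V} := HB.pack L (GRing.isLinear.Build _ _ _ _ _ Llin).
pose A : 'M[k]_(dim V) := lin1_mx (v2r \o L' \o r2v).
have dimV : (0 < dim V)%N.
  rewrite lt0n; apply/negP => /eqP dV; apply: w0.
  apply: (@v2r_inj _ V); apply/rowP => i.
  by have := ltn_ord i; rewrite [X in (_ < X)%N]dV.
have [l /eigenvalueP[v vA v0]] := eigenvalue_closed A dimV.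
exists l, (r2v v); split.
  by move/(congr1 v2r); rewrite r2vK linear0; apply/eqP.
apply: (@v2r_inj _ V); rewrite linearZ /= r2vK -vA.
by rewrite mul_rV_lin1.
Qed.

End Eigenvector.

Section LinearCategory.
Variables (k : fieldType) (C : linCat k).
Implicit Types X Y Z W : C.

(** Rewriting a composite of two factors inside a right-nested composite. *)
Lemma compm_rew X Y Z W (f : mor Y Z) (g : mor X Y) (h : mor X Z) (p : mor W X) :
  f \c g = h -> f \c (g \c p) = h \c p.
Proof. by move=> <-; rewrite compA. Qed.

Lemma compmDl X Y Z (c : k) (f f' : mor Y Z) (g : mor X Y) :
  (c *: f + f') \c g = c *: (f \c g) + f' \c g.
Proof. exact: (comp_linear_l g c f f'). Qed.

Lemma compmDr X Y Z (c : k) (f : mor Y Z) (g g' : mor X Y) :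
  f \c (c *: g + g') = c *: (f \c g) + f \c g'.
Proof. exact: (comp_linear_r f c g g'). Qed.

Lemma comp0m X Y Z (g : mor X Y) : (0 : mor Y Z) \c g = 0.
Proof. by rewrite -[in LHS](addNr (0 : mor Y Z)) -scaleN1r compmDl scaleN1r addNr. Qed.

Lemma compm0 X Y Z (g : mor Y Z) : g \c (0 : mor X Y) = 0.
Proof. by rewrite -[in LHS](addNr (0 : mor X Y)) -scaleN1r compmDr scaleN1r addNr. Qed.

Lemma compZm X Y Z (c : k) (f : mor Y Z) (g : mor X Y) :
  (c *: f) \c g = c *: (f \c g).
Proof. by rewrite -[in LHS](addr0 (c *: f)) compmDl comp0m addr0. Qed.

Lemma compmZ X Y Z (c : k) (f : mor Y Z) (g : mor X Y) :
  f \c (c *: g) = c *: (f \c g).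
Proof. by rewrite -[in LHS](addr0 (c *: g)) compmDr compm0 addr0. Qed.

Lemma compDm X Y Z (f f' : mor Y Z) (g : mor X Y) :
  (f + f') \c g = f \c g + f' \c g.
Proof. by rewrite -[in LHS](scale1r f) compmDl scale1r. Qed.

Lemma compmD X Y Z (f : mor Y Z) (g g' : mor X Y) :
  f \c (g + g') = f \c g + f \c g'.
Proof. by rewrite -[in LHS](scale1r g) compmDr scale1r. Qed.

Lemma comp_suml X Y Z n (f : 'I_n -> mor Y Z) (g : mor X Y) :
  (\sum_i f i) \c g = \sum_i (f i \c g).
Proof. by elim/big_rec2: _ => [|i u v _ <-]; rewrite ?comp0m ?compDm. Qed.

Lemma comp_sumr X Y Z n (f : mor Y Z) (g : 'I_n -> mor X Y) :
  f \c (\sum_i g i) = \sum_i (f \c g i).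
Proof. by elim/big_rec2: _ => [|i u v _ <-]; rewrite ?compm0 ?compmD. Qed.

Lemma kernel_mono K X Y (u : mor K X) (f : mor X Y) : is_kernel u f -> is_mono u.
Proof.
move=> [fu0 univ] W g h ugh.
have fuh : f \c (u \c h) = 0 by rewrite compA fu0 comp0m.
by have [w [_ wu]] := univ W _ fuh; rewrite -(wu g) // (wu h).
Qed.

Hypothesis kerC : forall X Y (f : mor X Y), exists K (u : mor K X), is_kernel u f.

Lemma simple_mono X Y (f : mor X Y) : is_simple X -> f <> 0 -> is_mono f.
Proof.
move=> [X0 simX] f0; have [K [u ku]] := kerC f.
case: (simX _ u (kernel_mono ku)) => [u0|[v [_ uv]]]; last first.
  by case: f0; rewrite -[f]compm1 -uv compA ku.1 comp0m.
move=> W g h fgh.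
have : f \c (g - h) = 0 by rewrite -scaleN1r addrC compmDr fgh scaleN1r addNr.
move/(ku.2 _) => [w [uw _]]; move: uw; rewrite u0 comp0m => /esym/eqP.
by rewrite subr_eq0 => /eqP.
Qed.

Lemma schur_iso X Y (f : mor X Y) : is_simple X -> is_simple Y -> f <> 0 -> is_iso f.
Proof.
by move=> sX [_ sY] f0; case: (sY _ f (simple_mono sX f0)).
Qed.

Lemma iso_simple X Y : isomorphic X Y -> is_simple X -> is_simple Y.
Proof.
move=> [f [g [gf fg]]] [X0 simX]; split.
  by move=> Y0; apply: X0; rewrite -gf -[f]comp1m Y0 comp0m compm0.
move=> W h hmono.
have ghmono : is_mono (g \c h).
  move=> U p q; rewrite -!compA => e; apply: hmono.
  by rewrite -[h \c p]comp1m -[h \c q]comp1m -fg -!compA e.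
case: (simX _ _ ghmono) => [gh0|[v [vgh ghv]]].
  by left; rewrite -[h]comp1m -fg -compA gh0 compm0.
right; exists (v \c g); split; first by rewrite -compA.
rewrite -[LHS]comp1m -{1}fg -compA [g \c (h \c _)]compA compA.
by rewrite [_ \c (v \c g)]compA -[f \c _ \c v]compA ghv compm1.
Qed.

(** The projector onto one simple summand is a nonzero scalar, so that this
    summand is everything. *)
Lemma scalar_end_simple X : is_semisimple C -> idm X <> 0 ->
  (forall f : mor X X, exists c, f = c *: idm X) -> is_simple X.
Proof.
move=> ssC X0 scX; have [n [S [i [p [simS [pi _ ip]]]]]] := ssC X.
case: n S i p simS pi ip => [|n] S i p simS pi ip.
  by case: X0; rewrite -ip big_ord0.
have [c ec] := scX (i ord0 \c p ord0).
have S0 := (simS ord0).1.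
have c0 : c != 0.
  apply/eqP=> c0; apply: S0; rewrite -(comp1m (idm _)) -{1}(pi ord0) -(pi ord0).
  by rewrite -compA (compm_rew _ ec) c0 scale0r comp0m compm0.
apply: iso_simple (simS ord0); exists (i ord0), (c^-1 *: p ord0); split.
  have e1 : c *: p ord0 = p ord0.
    by rewrite -{1}[p ord0]compm1 -compmZ -ec compA pi comp1m.
  have c1 : c = 1.
    have := congr1 (fun u => u \c i ord0) e1; rewrite compZm pi => /eqP.
    rewrite -subr_eq0 -{2}[idm _]scale1r -scalerBl scaler_eq0 subr_eq0.
    by case/orP=> [/eqP //|/eqP /S0].
  by rewrite c1 invr1 scale1r pi.
by rewrite compmZ ec scalerA mulVf // scale1r.
Qed.

End LinearCategory.

(** Subtracting from [f] an eigenvalue of left multiplication by [f] gives a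
    non-invertible endomorphism, which is therefore zero. *)
Lemma schur_scalar (k : numClosedFieldType) (C : linCat k) (X : C)
    (kerC : forall (X Y : C) (f : mor X Y), exists K (u : mor K X), is_kernel u f)
    (f : mor X X) : is_simple X -> exists c : k, f = c *: idm X.
Proof.
move=> sX; have X0 : idm X <> 0 := sX.1.
have flin : linear (fun g : mor X X => f \c g) by exact: comp_linear_r.
have [l [g [g0 fg]]] := exists_eigenvector flin X0.
exists l; apply: subr0_eq; apply: contrapT => fl0.
have [h [hfl _]] := schur_iso kerC sX sX fl0.
apply: g0; rewrite -[g]comp1m -hfl -compA compDm fg.
by rewrite -scaleNr compZm comp1m scaleNr subrr compm0.
Qed.

(** * Coherence in a tensor category *)

Section Coherence.
Variables (k : fieldType) (C : tensorCat k).
Implicit Types X Y Z W : C.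
Local Notation "1" := (tone C).

Lemma tenm_compl X X' X'' Y (f : mor X' X'') (g : mor X X') :
  (f \c g) \om idm Y = (f \om idm Y) \c (g \om idm Y).
Proof. by rewrite -tenm_comp comp1m. Qed.

Lemma tenm_compr X Y Y' Y'' (f : mor Y' Y'') (g : mor Y Y') :
  idm X \om (f \c g) = (idm X \om f) \c (idm X \om g).
Proof. by rewrite -tenm_comp comp1m. Qed.

Lemma tenm_lr X X' Y Y' (f : mor X X') (g : mor Y Y') :
  (f \om idm Y') \c (idm X \om g) = f \om g.
Proof. by rewrite -tenm_comp comp1m compm1. Qed.

Lemma tenm_rl X X' Y Y' (f : mor X X') (g : mor Y Y') :
  (idm X' \om g) \c (f \om idm Y) = f \om g.
Proof. by rewrite -tenm_comp comp1m compm1. Qed.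

Lemma ten0m X X' Y Y' (g : mor Y Y') : (0 : mor X X') \om g = 0.
Proof. by rewrite -[in LHS](addNr (0 : mor X X')) -scaleN1r tenmDl scaleN1r addNr. Qed.

Lemma tenm0 X X' Y Y' (f : mor X X') : f \om (0 : mor Y Y') = 0.
Proof. by rewrite -[in LHS](addNr (0 : mor Y Y')) -scaleN1r tenmDr scaleN1r addNr. Qed.

Lemma tenZm X X' Y Y' c (f : mor X X') (g : mor Y Y') :
  (c *: f) \om g = c *: (f \om g).
Proof. by rewrite -[in LHS](addr0 (c *: f)) tenmDl ten0m addr0. Qed.

Lemma tenmZ X X' Y Y' c (f : mor X X') (g : mor Y Y') :
  f \om (c *: g) = c *: (f \om g).
Proof. by rewrite -[in LHS](addr0 (c *: g)) tenmDr tenm0 addr0. Qed.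

Lemma lunV_nat X X' (f : mor X X') : (idm 1 \om f) \c lunV X = lunV X' \c f.
Proof.
by rewrite -[LHS]comp1m -lunK -!compA (compm_rew _ (lun_nat f)) -compA lunVK compm1.
Qed.

Lemma runV_nat X X' (f : mor X X') : (f \om idm 1) \c runV X = runV X' \c f.
Proof.
by rewrite -[LHS]comp1m -runK -!compA (compm_rew _ (run_nat f)) -compA runVK compm1.
Qed.

Lemma assV_nat X Y Z X' Y' Z' (f : mor X X') (g : mor Y Y') (h : mor Z Z') :
  assV X' Y' Z' \c (f \om (g \om h)) = ((f \om g) \om h) \c assV X Y Z.
Proof.
rewrite -[RHS]comp1m -assK -!compA; congr (_ \c _).
by rewrite (compm_rew _ (ass_nat f g h)) -compA assVK compm1.
Qed.

Lemma tone_faithful_l X Y (f g : mor X Y) : idm 1 \om f = idm 1 \om g -> f = g.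
Proof.
by move=> e; rewrite -[f]compm1 -[g]compm1 -(lunVK X) !compA -!lun_nat e.
Qed.

Lemma tone_faithful_r X Y (f g : mor X Y) : f \om idm 1 = g \om idm 1 -> f = g.
Proof.
by move=> e; rewrite -[f]compm1 -[g]compm1 -(runVK X) !compA -!run_nat e.
Qed.

(** This and [run_ass] are Kelly's consequences of the pentagon and the triangle:
    tensoring with the unit is faithful, and after tensoring, the pentagon with
    one unit argument reduces to two triangles. *)
Lemma lun_ass X Y : lun (X \ox Y) \c ass 1 X Y = lun X \om idm Y.
Proof.
apply: tone_faithful_l.
have assI : ass 1 (1 \ox X) Y \c (ass 1 1 X \om idm Y)
    \c ((assV 1 1 X \om idm Y) \c assV 1 (1 \ox X) Y) = idm _.
  rewrite -compA (compm_rew _ (esym (tenm_compl _ _ _))) assVK tenm1 comp1m.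
  exact: assVK.
rewrite -[LHS]compm1 -[RHS]compm1 -assI !compA; congr (_ \c _ \c _).
rewrite tenm_compr -!compA [_ \c (ass _ _ _ \c _)]compA -pentagon.
rewrite compA triangle -tenm1 -ass_nat -triangle tenm_compl.
by rewrite compA ass_nat -compA.
Qed.

Lemma run_ass X Y : (idm X \om run Y) \c ass X Y 1 = run (X \ox Y).
Proof.
apply: tone_faithful_r; rewrite -[LHS]comp1m -[RHS]comp1m -assK -!compA.
congr (_ \c _); rewrite -triangle -tenm1.
rewrite [RHS]compA ass_nat -compA pentagon.
rewrite tenm_compl compA ass_nat -!compA.
by rewrite -triangle tenm_compr -compA.
Qed.

Lemma lun_run1 : lun 1 = run 1.
Proof.
apply: tone_faithful_r; rewrite -lun_ass -triangle; congr (_ \c _).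
by rewrite -[LHS]comp1m -[RHS]comp1m -lunK -!compA lun_nat.
Qed.

Lemma lunV_runV1 : lunV 1 = runV 1.
Proof. by rewrite -[LHS]compm1 -(runVK 1) -lun_run1 compA lunK comp1m. Qed.

Lemma ass_lunV X Y : ass 1 X Y \c (lunV X \om idm Y) = lunV (X \ox Y).
Proof.
rewrite -[LHS]comp1m -lunK -!compA (compm_rew _ (lun_ass X Y)).
by rewrite -tenm_compl lunVK tenm1 compm1.
Qed.

Lemma assV_lunV X Y : assV 1 X Y \c lunV (X \ox Y) = lunV X \om idm Y.
Proof. by rewrite -ass_lunV compA assK comp1m. Qed.

Lemma ass_runV X Y : ass X Y 1 \c runV (X \ox Y) = idm X \om runV Y.
Proof.
have e : idm X \om runV Y = idm X \om runV Y \c run (X \ox Y) \c runV (X \ox Y).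
  by rewrite -compA runVK compm1.
by rewrite e -run_ass compA -tenm_compr runK tenm1 comp1m.
Qed.

Lemma run_assV X Y : run (X \ox Y) \c assV X Y 1 = idm X \om run Y.
Proof. by rewrite -run_ass -compA assVK compm1. Qed.

Lemma triangleV X Y : ass X 1 Y \c (runV X \om idm Y) = idm X \om lunV Y.
Proof.
rewrite -[LHS]comp1m -tenm1 -(lunK Y) tenm_compr -!compA.
by rewrite (compm_rew _ (triangle X Y)) -tenm_compl runVK tenm1 compm1.
Qed.

Lemma pentagon_l W X Y Z :
  (idm W \om assV X Y Z) \c (ass W X (Y \ox Z) \c ass (W \ox X) Y Z) =
  ass W (X \ox Y) Z \c (ass W X Y \om idm Z).
Proof.
rewrite pentagon -!compA (compm_rew _ (esym (tenm_compr _ _ _))).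
by rewrite assK tenm1 comp1m.
Qed.

Lemma pentagon_r W X Y Z :
  ass (W \ox X) Y Z \c (assV W X Y \om idm Z) =
  assV W X (Y \ox Z) \c (idm W \om ass X Y Z) \c ass W (X \ox Y) Z.
Proof.
rewrite -[LHS]comp1m -assK -!compA (compm_rew _ (pentagon W X Y Z)) -!compA.
by rewrite -tenm_compl assVK tenm1 compm1.
Qed.

(** The composites in the zigzag identities, and the mates of morphisms, are
    instances of this bent strand or of its mirror image [contract_l]. *)
Definition contract_r Z X Y (e : mor (Z \ox X) 1) (f : mor 1 (X \ox Y)) : mor Z Y :=
  lun Y \c (e \om idm Y) \c assV Z X Y \c (idm Z \om f) \c runV Z.

Definition contract_l W Z X (f : mor 1 (W \ox Z)) (e : mor (Z \ox X) 1) : mor X W :=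
  run W \c (idm W \om e) \c ass W Z X \c (f \om idm X) \c lunV X.

(** Both sides are the composite of [f] and [g], side by side, with [e] capping
    the two middle strands; only the order of tensoring differs. *)
Lemma contract_cup W Z X Y (f : mor 1 (W \ox Z)) (e : mor (Z \ox X) 1)
    (g : mor 1 (X \ox Y)) :
  (contract_l f e \om idm Y) \c g = (idm W \om contract_r e g) \c f.
Proof.
rewrite /contract_l /contract_r !tenm_compl !tenm_compr -!compA.
rewrite -ass_runV -!compA -runV_nat (compm_rew _ (esym (ass_nat _ _ _))) tenm1.
rewrite -!compA (compm_rew _ (tenm_rl f g)) -(tenm_lr f g) -lunV_runV1 -!compA.
rewrite lunV_nat -ass_lunV -!compA -(tenm1 X Y) (compm_rew _ (esym (ass_nat _ _ _))).
rewrite -!compA [ass _ _ _ \c (ass _ _ _ \c _)]compA (compm_rew _ (pentagon_l _ _ _ _)).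
rewrite -!compA (compm_rew _ (esym (ass_nat _ _ _))) -!compA.
by rewrite (compm_rew _ (triangle _ _)).
Qed.

(** The upside-down form of [contract_cup]. *)
Lemma contract_cap Z X Y X' (e : mor (Z \ox X) 1) (f : mor 1 (X \ox Y))
    (e' : mor (Y \ox X') 1) :
  e' \c (contract_r e f \om idm X') = e \c (idm Z \om contract_l f e').
Proof.
rewrite /contract_l /contract_r !tenm_compl !tenm_compr -!compA.
rewrite -lun_ass -!compA (compm_rew _ (esym (lun_nat e'))) -!compA.
rewrite (compm_rew _ (ass_nat _ _ _)) -!compA (compm_rew _ (pentagon_r _ _ _ _)).
rewrite -!compA (compm_rew _ (ass_nat _ _ _)) -!compA triangleV tenm1.
rewrite (compm_rew _ (tenm_rl e e')) -(tenm_lr e e') -!compA.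
rewrite lun_run1 (compm_rew _ (run_nat e)) -!compA -tenm1.
by rewrite (compm_rew _ (esym (assV_nat _ _ _))) -!compA (compm_rew _ (run_assV _ _)).
Qed.

End Coherence.

(** * Duals, traces and dimensions *)

Section Duality.
Variables (k : fieldType) (C : tensorCat k).
Implicit Types X Y Z W : C.
Local Notation "1" := (tone C).

Lemma contract_l_coev X : contract_l (coev X) (ev X) = idm X.
Proof. exact: dual_zigzag. Qed.

Lemma contract_r_coev X : contract_r (ev X) (coev X) = idm (ldual X).
Proof. exact: dual_zigzagV. Qed.

(** Together with [coev_inj], this is the adjunction between tensoring with [X]
    and with [ldual X], at the unit object. *)
Lemma cup_coev X Y (f : mor 1 (X \ox Y)) :
  f = (idm X \om contract_r (ev X) f) \c coev X.
Proof. by rewrite -contract_cup contract_l_coev tenm1 comp1m. Qed.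

Lemma cup_coev_l W X (f : mor 1 (W \ox ldual X)) :
  f = (contract_l f (ev X) \om idm (ldual X)) \c coev X.
Proof. by rewrite contract_cup contract_r_coev tenm1 comp1m. Qed.

Lemma contract_r_comp Z X Y Y' (e : mor (Z \ox X) 1) (f : mor 1 (X \ox Y))
    (g : mor Y Y') :
  contract_r e ((idm X \om g) \c f) = g \c contract_r e f.
Proof.
rewrite /contract_r tenm_compr !compA -lun_nat; congr (_ \c _ \c _).
rewrite -!compA; congr (_ \c _).
by rewrite assV_nat tenm1 compA tenm_lr compA tenm_rl.
Qed.

Lemma coev_inj X Y (g g' : mor (ldual X) Y) :
  (idm X \om g) \c coev X = (idm X \om g') \c coev X -> g = g'.
Proof.
move=> /(congr1 (contract_r (ev X))).
by rewrite !contract_r_comp contract_r_coev !compm1.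
Qed.

Lemma ev_mate Z X (e : mor (Z \ox X) 1) : ev X \c (mate e \om idm X) = e.
Proof. by rewrite [LHS]contract_cap contract_l_coev tenm1 compm1. Qed.

Lemma ev_dualm X Y (f : mor X Y) :
  ev X \c (dualm f \om idm X) = ev Y \c (idm (ldual Y) \om f).
Proof. exact: ev_mate. Qed.

Lemma coev_dualm X Y (f : mor X Y) :
  (idm Y \om dualm f) \c coev Y = (f \om idm (ldual X)) \c coev X.
Proof.
rewrite [RHS]cup_coev; congr ((_ \om _) \c _).
rewrite /dualm /mate /contract_r tenm_compl -!compA; congr (_ \c (_ \c _)).
by rewrite (compm_rew _ (esym (assV_nat _ _ _))) tenm_compr -!compA.
Qed.

Lemma coev_neq0 X : idm X <> 0 -> coev X <> 0.
Proof.
move=> X0 c0; apply: X0.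
by rewrite -contract_l_coev /contract_l c0 ten0m compm0 comp0m.
Qed.

Lemma ldual_neq0 X : idm X <> 0 -> idm (ldual X) <> 0.
Proof.
move=> X0 d0; apply: (coev_neq0 X0).
by rewrite -[coev X]comp1m -tenm1 d0 tenm0 comp0m.
Qed.

(** An endomorphism of the dual slides along the coevaluation to one of [X]. *)
Lemma scalar_end_ldual X :
  (forall f : mor X X, exists c, f = c *: idm X) ->
  forall g : mor (ldual X) (ldual X), exists c, g = c *: idm (ldual X).
Proof.
move=> scX g; have [c ec] := scX (contract_l ((idm X \om g) \c coev X) (ev X)).
exists c; apply: coev_inj; rewrite [LHS]cup_coev_l ec.
by rewrite tenZm tenmZ.
Qed.

Lemma coev_span X (f : mor 1 (X \ox ldual X)) :
  (forall f : mor X X, exists c, f = c *: idm X) -> exists c, f = c *: coev X.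
Proof.
move=> scX; have [c ec] := scX (contract_l f (ev X)).
by exists c; rewrite [LHS]cup_coev_l ec tenZm tenm1 compZm comp1m.
Qed.

Variable a : pivotal C.

(** The mate of [e] goes from [X] to its double dual, which the pivotal structure
    identifies with [X]. *)
Lemma right_ev_span X (e : mor (X \ox ldual X) 1) :
  (forall f : mor X X, exists c, f = c *: idm X) -> exists c, e = c *: right_ev a X.
Proof.
move=> scX; have [b [ba ab]] := piv_iso a X.
have [c ec] := scX (b \c mate e); exists c.
have eM : mate e = c *: a X by rewrite -[LHS]comp1m -ab -compA ec compmZ compm1.
by rewrite -[LHS]ev_mate eM tenZm compmZ.
Qed.

Definition ptrace X (f : mor X X) : mor 1 1 :=
  right_ev a X \c (f \om idm (ldual X)) \c coev X.

(** Naturality of the pivotal structure is what makes right evaluations dinatural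
    too; with [coev_dualm] it lets morphisms travel around a loop. *)
Lemma right_ev_dualm X Y (f : mor X Y) :
  right_ev a Y \c (f \om idm (ldual Y)) = right_ev a X \c (idm X \om dualm f).
Proof.
rewrite /right_ev -!compA -tenm_compl piv_nat tenm_compl compA ev_dualm.
by rewrite -compA tenm_rl tenm_lr.
Qed.

Lemma ptraceC X Y (f : mor Y X) (g : mor X Y) : ptrace (f \c g) = ptrace (g \c f).
Proof.
rewrite /ptrace !tenm_compl [X in X \c _ = _]compA right_ev_dualm -!compA.
by congr (_ \c (_ \c _)); rewrite compA tenm_rl -tenm_lr -compA coev_dualm.
Qed.

Lemma qdim_trace X : qdim a X = scal (ptrace (idm X)).
Proof. by rewrite /qdim /ptrace tenm1 compm1. Qed.

Lemma qdim_iso X Y : isomorphic X Y -> qdim a X = qdim a Y.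
Proof. by move=> [f [g [gf fg]]]; rewrite !qdim_trace -gf ptraceC fg. Qed.

Lemma ptrace_sum X n (f : 'I_n -> mor X X) : ptrace (\sum_i f i) = \sum_i ptrace (f i).
Proof.
rewrite /ptrace -comp_suml -comp_sumr; congr (_ \c _ \c _).
elim/big_rec2: _ => [|i u v _ <-]; first by rewrite ten0m.
by rewrite -[f i]scale1r tenmDl !scale1r.
Qed.

Lemma qdim_biproduct n (S : 'I_n -> C) X i p :
  @is_biproduct k C n S X i p -> qdim a X = \sum_j qdim a (S j).
Proof.
move=> [pi _ ip]; rewrite qdim_trace -ip ptrace_sum /scal linear_sum.
by apply: eq_bigr => j _; rewrite ptraceC pi qdim_trace.
Qed.

End Duality.

Section Fusion.
Variables (k : numClosedFieldType) (C : tensorCat k) (n : nat) (M : 'I_n -> C).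
Hypothesis C_fusion : is_fusion M.
Implicit Types X Y : C.
Local Notation "1" := (tone C).

Lemma fusion_kernel X Y (f : mor X Y) : exists K (u : mor K X), is_kernel u f.
Proof. by case: C_fusion => -[_ kerC _ _ _] _ _ _ _; apply: kerC. Qed.

Lemma fusion_schur X (f : mor X X) : is_simple X -> exists c : k, f = c *: idm X.
Proof. exact: (schur_scalar fusion_kernel). Qed.

Lemma simpleM i : is_simple (M i).
Proof. by case: C_fusion => _ _ _ _ []. Qed.

Lemma simple_ldual X : is_simple X -> is_simple (ldual X).
Proof.
move=> sX; case: C_fusion => _ ssC _ _ _; apply: scalar_end_simple => //.
  exact: ldual_neq0 sX.1.
by apply: scalar_end_ldual => f; apply: fusion_schur.
Qed.

(** By duality a morphism from the unit to [X Y] is a morphism from [ldual X]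
    to [Y], and both objects are simple. *)
Lemma unit_multiplicity X Y : is_simple X -> is_simple Y ->
  \dim {: mor 1 (X \ox Y)} <> 0%N ->
  \dim {: mor 1 (X \ox Y)} = 1%N /\ isomorphic (ldual X) Y.
Proof.
move=> sX sY dXY.
have [f f0] : exists f : mor 1 (X \ox Y), f <> 0.
  apply: contrapT => nof; apply: dXY; apply/eqP; rewrite dimv_eq0 -subv0.
  apply/subvP => f _; rewrite memv0; apply/eqP.
  by apply: contrapT => f0; apply: nof; exists f.
pose g := contract_r (ev X) f.
have g0 : g <> 0 by move=> g0; apply: f0; rewrite [f]cup_coev -/g g0 tenm0 comp0m.
have sX' := simple_ldual sX.
have [h [hg gh]] := schur_iso fusion_kernel sX' sY g0.
split; last by exists g, h.
suff -> : {: mor 1 (X \ox Y)}%VS = <[f]>%VS by rewrite dim_vline; move/eqP: f0 => ->.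
apply/eqP; rewrite eqEsubv subvf andbT; apply/subvP => f' _; apply/vlineP.
have [c ec] := fusion_schur (h \c contract_r (ev X) f') sX'.
exists c; rewrite [f']cup_coev [f in RHS]cup_coev -/g.
have -> : contract_r (ev X) f' = c *: g.
  by rewrite -[LHS]comp1m -gh -compA ec compmZ compm1.
by rewrite tenmZ compZm.
Qed.

Lemma unit_multiplicity_ex X : is_simple X ->
  exists j, \dim {: mor 1 (X \ox M j)} <> 0%N.
Proof.
move=> sX; case: C_fusion => _ _ _ _ [_ _ repM].
have [j [u [v [vu uv]]]] := repM _ (simple_ldual sX).
exists j => /eqP; rewrite dimv_eq0 => /eqP dim0.
have : (idm X \om u) \c coev X \in {: mor 1 (X \ox M j)}%VS by rewrite memvf.
rewrite dim0 memv0 => /eqP e0; apply: (ldual_neq0 sX.1).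
have u0 : u = 0 by apply: coev_inj; rewrite e0 tenm0 comp0m.
by rewrite -vu u0 compm0.
Qed.

Variable a : pivotal C.
Hypothesis C_integral : is_integral M.
Hypothesis a_canonical : is_canonical_spherical M a.

(** A Frobenius-Perron dimension is unique, being the largest nonnegative
    eigenvalue, so the dimension of the spherical structure is the integral one. *)
Lemma qdim_simple X : is_simple X -> exists2 d : nat, (0 < d)%N & qdim a X = d%:R.
Proof.
move=> sX; have [d d0 [dge deig dmax]] := C_integral sX.
have [qge qeig qmax] := a_canonical.2 _ sX.
by exists d => //; apply/eqP; rewrite eq_le dmax // qmax.
Qed.

(** Quantum dimension is additive, so it counts the simple summands with
    positive integral weights. *)
Lemma qdim_nat X : idm X <> 0 -> exists2 d : nat, (0 < d)%N & qdim a X = d%:R.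
Proof.
case: C_fusion => _ ssC _ _ _ X0; have [r [S [i [p [simS bip]]]]] := ssC X.
have [d dP] : exists d : 'I_r -> nat, forall j, (0 < d j)%N /\ qdim a (S j) = (d j)%:R.
  exists (fun j => s2val (cid2 (qdim_simple (simS j)))) => j.
  by case: (cid2 _).
exists (\sum_j d j)%N; last first.
  rewrite (qdim_biproduct a bip) natr_sum.
  by apply: eq_bigr => j _; rewrite (dP j).2.
case: r S i p simS bip d dP => [|r] S i p simS bip d dP.
  by case: bip => _ _; rewrite big_ord0 => /esym.
by rewrite big_ord_recl ltn_addr // (dP ord0).1.
Qed.

End Fusion.

(** * The action of central elements on objects *)

Lemma center_simple_neq0 (k : fieldType) (C : tensorCat k) (V : drinfeld_center C) :
  is_simple V -> idm (cobj V) <> 0.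
Proof.
move=> [V0 _] id0; apply: V0; apply: (@subvs_inj _ _ (center_vs V V)).
by rewrite [LHS](center_idE V) id0 linear0.
Qed.

Section AdjointAlgebra.
Variables (k : fieldType) (C : tensorCat k) (A : adjointAlg C).
Implicit Types X Y : C.
Local Notation "1" := (tone C).
Local Notation eps := (counit A).
Local Notation beta := (hbr (radj A)).

Definition half_action X (b : CE A) : mor X (X \ox adj A) :=
  beta X \c (b \om idm X) \c lunV X.

(** The component at [X] of the endomorphism of the identity functor given by the
    central element [b]. *)
Definition action X (b : CE A) : mor X X :=
  run X \c (idm X \om eps) \c half_action X b.

(** The half-braiding of the tensor square of the adjoint algebra is the composite
    of two half-braidings, and multiplication commutes with half-braidings. *)
Lemma action_mul X (b b' : CE A) : action X (ce_mul b b') = action X b \c action X b'.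
Proof.
set y := half_action X b'.
have lhsE : half_action X (ce_mul b b') = (idm X \om amul A)
    \c ass X (adj A) (adj A) \c (half_action X b \om idm (adj A)) \c y.
  rewrite {1}/half_action /ce_mul !tenm_compl -!compA.
  rewrite (compm_rew _ (esym (amul_central A X))) /hbr_tensor -!compA.
  rewrite (compm_rew _ (ass_nat b b' (idm X))) -!compA (compm_rew _ (ass_lunV 1 X)).
  rewrite -lunV_nat [_ \c (_ \c (_ \c lunV X))]compA -tenm_comp comp1m.
  rewrite [_ \c (_ \c lunV X)]compA -tenm_comp compm1 -/(half_action X b') -/y.
  rewrite -(tenm_lr b y) -!compA lunV_nat -tenm1 (compm_rew _ (assV_nat _ _ _)).
  by rewrite -!compA (compm_rew _ (assV_lunV _ _)).
rewrite /action lhsE -/y; move: (half_action X b) => h; clearbody y.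
rewrite -!compA (compm_rew _ (esym (tenm_compr _ _ _))).
rewrite amul_counit tenm_compr -!compA (compm_rew _ (esym (ass_nat _ _ _))).
rewrite -!compA (compm_rew _ (triangle _ _)) -(tenm_lr (_ \om eps) eps) -!compA.
rewrite (compm_rew _ (tenm_rl h eps)) -(tenm_lr h) -!compA.
by rewrite !(compm_rew _ (esym (tenm_compl _ _ _))) (compm_rew _ (run_nat _)) -!compA.
Qed.

Lemma action_one X : action X (ce_one A) = idm X.
Proof.
rewrite /action /half_action /ce_one -!compA (compm_rew _ (esym (aunit_central A X))).
rewrite -!compA (compm_rew _ (esym (tenm_compr _ _ _))) aunit_counit tenm1 comp1m.
by rewrite /hbr_one -?compA lunVK compm1 runVK.
Qed.

(** The components of [b] in the decomposition of the adjoint algebra are the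
    names of its actions. *)
Lemma adj_proj_action X (b : CE A) :
  adj_proj A X \c b = (action X b \om idm (ldual X)) \c coev X.
Proof.
rewrite /adj_proj /action /half_action !tenm_compl -!compA.
do 3 congr (_ \c _).
rewrite -runV_nat (compm_rew _ (tenm_rl b (coev X))) -(tenm_lr b (coev X)).
rewrite -!compA -lunV_runV1 lunV_nat -tenm1 (compm_rew _ (assV_nat _ _ _)).
by rewrite -!compA (compm_rew _ (assV_lunV _ _)).
Qed.

End AdjointAlgebra.

(** * The Galois action on a character table *)

(** The rows of [B] are the coordinate characters of the algebra k^n, written in
    the basis formed by its columns, and [c] holds the structure constants of that
    basis.  A further character [x] is a combination [y] of the rows; [y] then
    satisfies y_i y_i' = delta_ii' y_i, so it is a standard basis vector. *)
Lemma character_row (k : fieldType) n (B : 'M[k]_n) (c : 'I_n -> 'I_n -> 'I_n -> k)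
    (x : 'I_n -> k) :
  B \in unitmx ->
  (forall i j l, B i j * B i l = \sum_p c j l p * B i p) ->
  (forall j l, x j * x l = \sum_p c j l p * x p) ->
  (exists j, x j <> 0) ->
  exists i, forall j, x j = B i j.
Proof.
move=> uB Bmul xmul [j0 xj0].
pose X : 'rV_n := \row_j x j; pose y := X *m invmx B.
have xE j : x j = \sum_i y 0 i * B i j.
  by have /rowP/(_ j) := mulmxKV uB X; rewrite -/y !mxE => <-.
(* Multiplicativity of [x] says that the form [T] vanishes on columns of [B]. *)
pose T := y^T *m y - diag_mx y.
have BTB : B^T *m T *m B = 0.
  have -> : B^T *m T *m B = X^T *m X - B^T *m diag_mx y *m B.
    by rewrite -(mulmxKV uB X) -/y trmx_mul mulmxBr mulmxBl !mulmxA.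
  apply/matrixP => j l; rewrite mul_mx_diag !mxE big_ord1 !mxE xmul.
  under eq_bigr do rewrite xE mulr_sumr.
  rewrite exchange_big /= -sumrB big1 // => i _.
  rewrite !mxE mulrAC Bmul mulr_suml -sumrB big1 // => p _.
  by rewrite mulrCA mulrC subrr.
have T0 : T = 0.
  have uBT : B^T \in unitmx by rewrite unitmx_tr.
  by rewrite -(mulKmx uBT T) -(mulmxK uB (B^T *m T)) BTB mul0mx mulmx0.
have yy i i' : y 0 i * y 0 i' = y 0 i *+ (i == i').
  by have /matrixP/(_ i i') := T0; rewrite !mxE big_ord1 !mxE => /subr0_eq.
have [i yi] : exists i, y 0 i <> 0.
  apply: contrapT => noy; apply: xj0; rewrite xE big1 // => i _.
  have -> : y 0 i = 0 by apply: contrapT => yi; apply: noy; exists i.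
  by rewrite mul0r.
exists i => j; rewrite xE (bigD1 i) //= big1 ?addr0 => [|i' /negPf i'i].
  have /eqP := yy i i; rewrite eqxx -subr_eq0 -{3}[y 0 i]mulr1 -mulrBr mulf_eq0.
  by case/orP=> [/eqP/yi //|]; rewrite subr_eq0 => /eqP ->; rewrite mul1r.
have /eqP := yy i i'; rewrite [i == _]eq_sym i'i mulr0n mulf_eq0.
case/orP=> [/eqP/yi //|/eqP ->].
by rewrite mul0r.
Qed.

Section FieldAutomorphism.
Variables (k : numFieldType) (G : set k) (s : k -> k).
Let K := generated_field G.
Hypothesis s_aut : is_field_aut K s.

Lemma gen_sub x : G x -> K x.
Proof. by move=> Gx S _; apply. Qed.

Lemma gen1 : K 1.
Proof. by move=> S [S1 _ _] _. Qed.

Lemma genB x y : K x -> K y -> K (x - y).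
Proof.
by move=> Kx Ky S dS GS; case: (dS) => _ SB _; apply: SB; [exact: Kx|exact: Ky].
Qed.

Lemma genV x y : K x -> K y -> K (x / y).
Proof.
by move=> Kx Ky S dS GS; case: (dS) => _ _ SV; apply: SV; [exact: Kx|exact: Ky].
Qed.

Lemma gen0 : K 0.
Proof. by rewrite -(subrr 1); apply: genB; exact: gen1. Qed.

Lemma genD x y : K x -> K y -> K (x + y).
Proof.
move=> Kx Ky; rewrite -[y]opprK; apply: genB => //; rewrite -[- y]add0r.
by apply: genB => //; exact: gen0.
Qed.

Lemma genM x y : K x -> K y -> K (x * y).
Proof.
move=> Kx Ky; rewrite -[y]invrK; apply: genV => //; rewrite -[y^-1]mul1r.
by apply: genV => //; exact: gen1.
Qed.

Lemma gen_nat n : K n%:R.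
Proof.
elim: n => [|n IH]; first exact: gen0.
by rewrite -natr1; apply: genD => //; exact: gen1.
Qed.

Lemma gen_rat q : K (ratr q).
Proof.
have Kz z : K z%:~R.
  case: z => n; first exact: gen_nat.
  by rewrite NegzE mulrNz -[- _]add0r; apply: genB; [exact: gen0|exact: gen_nat].
by rewrite /ratr; apply: genV.
Qed.

Lemma aut1 : s 1 = 1. Proof. by case: s_aut. Qed.

Lemma autD x y : K x -> K y -> s (x + y) = s x + s y.
Proof. by case: s_aut => _ _ sD _; apply: sD. Qed.

Lemma autM x y : K x -> K y -> s (x * y) = s x * s y.
Proof. by case: s_aut => _ _ _ sM; apply: sM. Qed.

Lemma aut0 : s 0 = 0.
Proof.
have := autD gen0 gen0; rewrite addr0 => /eqP.
by rewrite -subr_eq0 opprD addrA subrr sub0r oppr_eq0 => /eqP.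
Qed.

Lemma aut_inj x y : K x -> K y -> s x = s y -> x = y.
Proof. by case: s_aut => -[_ sI _] _ _ _ Kx Ky; apply: sI; rewrite inE. Qed.

Lemma aut_sum n (f : 'I_n -> k) : (forall i, K (f i)) -> s (\sum_i f i) = \sum_i s (f i).
Proof.
move=> Kf; suff [] : K (\sum_i f i) /\ s (\sum_i f i) = \sum_i s (f i) by [].
elim/big_rec2: _ => [|i x y _ [Ky sy]]; first by rewrite aut0; split=> //; exact: gen0.
by split; [exact: genD|rewrite autD // sy].
Qed.

Lemma aut_nat n : s n%:R = n%:R.
Proof.
elim: n => [|n IH]; first exact: aut0.
by rewrite -natr1 autD ?IH ?aut1 //; [exact: gen_nat|exact: gen1].
Qed.

Lemma aut_rat q : s (ratr q) = ratr q.
Proof.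
have sz z : s z%:~R = z%:~R.
  case: z => n; first exact: aut_nat.
  apply/eqP; rewrite -subr_eq0 NegzE mulrNz opprK; apply/eqP.
  rewrite -[X in _ + X = _]aut_nat -autD ?addNr ?aut0 //; last exact: gen_nat.
  by rewrite -[- _]add0r; apply: genB; [exact: gen0|exact: gen_nat].
have d0 : (denq q)%:~R != 0 :> k by rewrite intr_eq0 denq_neq0.
have dn : ratr q * (denq q)%:~R = (numq q)%:~R :> k by rewrite /ratr divfK.
have Kd : K (denq q)%:~R by rewrite -(ratr_int k); exact: gen_rat.
apply: (mulIf d0); rewrite dn -{1}(sz (denq q)) -autM //; last exact: gen_rat.
by rewrite dn sz.
Qed.

End FieldAutomorphism.

Section CharacterTable.
Variables (k : numFieldType) (n : nat) (alpha : 'M[k]_n.+1) (s : k -> k).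
Let K := generated_field [set alpha i j | i in setT & j in setT]%classic.
Hypothesis s_aut : is_field_aut K s.
Hypothesis alpha_unit : alpha \in unitmx.
Variable d : 'I_n.+1 -> nat.
Hypothesis d_gt0 : forall i, (0 < d i)%N.
Hypothesis alpha_col0 : forall i, alpha i ord0 = (d i)%:R.
Hypothesis alpha_row0 : forall j, alpha ord0 j = 1.
Variable N : 'I_n.+1 -> 'I_n.+1 -> 'I_n.+1 -> nat.
Hypothesis alphaM : forall i i' j,
  alpha i j * alpha i' j = \sum_l (N i i' l)%:R * alpha l j.

Let Kalpha i j : K (alpha i j).
Proof. by apply: gen_sub; exists i => //; exists j. Qed.

Let d_neq0 i : (d i)%:R != 0 :> k.
Proof. by rewrite pnatr_eq0 -lt0n. Qed.

(** The columns of [alpha] are the characters of the Grothendieck ring, whose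
    structure constants are integers. *)
Lemma galois_column j : exists l, forall i, s (alpha i j) = alpha i l.
Proof.
have [||||l lP] := @character_row k n.+1 alpha^T (fun i i' l => (N i i' l)%:R)
  (fun i => s (alpha i j)).
- by rewrite unitmx_tr.
- move=> j' i i'; rewrite !mxE alphaM.
  by apply: eq_bigr => l _; rewrite mxE.
- move=> i i'; rewrite /= -(autM s_aut (Kalpha i j) (Kalpha i' j)) alphaM.
  rewrite (aut_sum s_aut) => [|l].
    apply: eq_bigr => l _.
    by rewrite (autM s_aut) ?(aut_nat s_aut) //; do ?[exact: gen_nat|exact: Kalpha].
  by apply: genM; [exact: gen_nat|exact: Kalpha].
- by exists ord0; rewrite alpha_row0 (aut1 s_aut); apply/eqP/oner_neq0.
by exists l => i; rewrite lP mxE.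
Qed.

Lemma tauP i j : s (alpha i j) = alpha i (tau alpha s j).
Proof.
rewrite /tau; case: pickP => [l /forallP/(_ i)/eqP //|noL].
have [l lP] := galois_column j; have := noL l; case/negP.
by apply/forallP => i'; rewrite lP.
Qed.

Variables (dcl : 'I_n.+1 -> nat) (c : 'I_n.+1 -> 'I_n.+1 -> 'I_n.+1 -> k).
Hypothesis dcl_gt0 : forall j, (0 < dcl j)%N.
Hypothesis c_rat : forall i j l, exists q : rat, c i j l = ratr q.

(** The values of the central characters at the class sums. *)
Let omega i j := (dcl j)%:R * alpha i j / (d i)%:R.
Hypothesis omegaM : forall i j l, omega i j * omega i l = \sum_p c j l p * omega i p.

Let Komega i j : K (omega i j).
Proof. by apply: genV; [apply: genM; [exact: gen_nat|exact: Kalpha]|exact: gen_nat]. Qed.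

Let s_omega i j : s (omega i j) = (dcl j)%:R * s (alpha i j) / (d i)%:R.
Proof.
have KV : K (d i)%:R^-1.
  by rewrite -[_^-1]mul1r; apply: genV; [exact: gen1|exact: gen_nat].
have sV : s (d i)%:R^-1 = (d i)%:R^-1.
  apply: (mulIf (d_neq0 i)); rewrite -[X in _ * X = _](aut_nat s_aut) -(autM s_aut) //.
    by rewrite mulVf // (aut1 s_aut).
  exact: gen_nat.
rewrite /omega (autM s_aut) ?sV //; last first.
  by apply: genM; [exact: gen_nat|exact: Kalpha].
by rewrite (autM s_aut) ?(aut_nat s_aut) //; [exact: gen_nat|exact: Kalpha].
Qed.

(** The class sums have rational structure constants, so [s] carries
    central characters to central characters; the factors [dcl j], also rational, cancel. *)
Lemma galois_row i : exists i', forall j,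
  s (alpha i j) / (d i)%:R = alpha i' j / (d i')%:R.
Proof.
pose B : 'M_n.+1 := \matrix_(i, j) omega i j.
have uB : B \in unitmx.
  pose D : 'M[k]_n.+1 := diag_mx (\row_i (d i)%:R^-1).
  pose L : 'M[k]_n.+1 := diag_mx (\row_j (dcl j)%:R).
  have -> : B = D *m alpha *m L.
    apply/matrixP => i' j; rewrite mul_mx_diag mul_diag_mx !mxE /omega.
    by rewrite [RHS]mulrC [_^-1 * _]mulrC mulrA.
  rewrite !unitmx_mul alpha_unit !unitmxE !det_diag !unitfE andbT.
  apply/andP; split; apply/prodf_neq0 => j _; rewrite mxE ?invr_eq0 //.
  by rewrite pnatr_eq0 -lt0n.
have [||||i' iP] := @character_row k n.+1 B c (fun j => s (omega i j)).
- by [].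
- by move=> i' j l; rewrite !mxE omegaM; apply: eq_bigr => p _; rewrite mxE.
- move=> j l; rewrite /= -(autM s_aut (Komega i j) (Komega i l)) omegaM.
  rewrite (aut_sum s_aut) => [|p]; last first.
    by have [q ->] := c_rat j l p; apply: genM; [exact: gen_rat|exact: Komega].
  apply: eq_bigr => p _; have [q ->] := c_rat j l p.
  by rewrite (autM s_aut) ?(aut_rat s_aut) //; [exact: gen_rat|exact: Komega].
- exists ord0; rewrite s_omega alpha_col0 (aut_nat s_aut) mulfK //.
  by apply/eqP; rewrite pnatr_eq0 -lt0n.
exists i' => j; have := iP j; rewrite mxE s_omega /omega -!mulrA.
by apply: mulfI; rewrite pnatr_eq0 -lt0n.
Qed.

Hypothesis N0_one : forall i i', N i i' ord0 <> 0%N -> N i i' ord0 = 1%N /\ d i = d i'.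
Hypothesis N0_ex : forall i, exists i', N i i' ord0 <> 0%N.

(** Comparing unit coefficients in the [s]-image of the fusion rule of [i] and its
    dual [i'] gives (d i / d (e i)) * (d i' / d (e i')) = 1, where [e] is the map of indices
    of [galois_row], [d i' = d i] and [d (e i') = d (e i)]. *)
Lemma galois_row_perm : exists eta : 'S_n.+1, forall i,
  d (eta i) = d i /\ forall j, s (alpha i j) = alpha (eta i) j.
Proof.
pose e i := sval (cid (galois_row i)).
pose q i : k := (d i)%:R / (d (e i))%:R.
have sE i j : s (alpha i j) = q i * alpha (e i) j.
  have := svalP (cid (galois_row i)) j; rewrite -/(e i) => h.
  by rewrite -[LHS](divfK (d_neq0 i)) h /q mulrC mulrCA mulrC -mulrA [_^-1 * _]mulrC.
have q0 i : q i != 0 by rewrite mulf_neq0 ?invr_eq0.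
have row_lin (u v : 'I_n.+1 -> k) :
    (forall j, \sum_i u i * alpha i j = \sum_i v i * alpha i j) -> u =1 v.
  move=> uv i.
  have : (\row_i u i) *m alpha = (\row_i v i) *m alpha.
    by apply/rowP => j; rewrite !mxE; under eq_bigr do rewrite mxE; rewrite uv;
       under [RHS]eq_bigr do rewrite mxE.
  by move/(can_inj (mulmxK alpha_unit))/rowP/(_ i); rewrite !mxE.
have sum1 (f : 'I_n.+1 -> k) i : \sum_i' (f i' *+ (i' == i)) = f i.
  by rewrite (bigD1 i) //= eqxx big1 ?addr0 // => i' /negPf ->.
have row1 (x : k) i j : x * alpha i j = \sum_i' (x *+ (i' == i)) * alpha i' j.
  rewrite -[LHS](sum1 (fun i' => x * alpha i' j)).
  by apply: eq_bigr => i' _; rewrite mulrnAl.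
have row_eq x y i i' : x != 0 -> (forall j, x * alpha i j = y * alpha i' j) -> i = i'.
  move=> x0 xy; have : x *+ (i == i) = y *+ (i == i').
    apply: (row_lin (fun l => x *+ (l == i)) (fun l => y *+ (l == i'))) => j.
    by rewrite -!row1.
  case: (eqVneq i i') => // _; rewrite eqxx mulr0n mulr1n => xy0.
  by rewrite xy0 eqxx in x0.
(* Proportional rows: [s] is injective on [K] and fixes the integers [d i]. *)
have e_inj : injective e.
  move=> i i' ee; apply: (@row_eq (d i')%:R (d i)%:R) => // j.
  apply: (aut_inj s_aut); rewrite ?(autM s_aut) ?(aut_nat s_aut) //;
    do ?[exact: Kalpha | exact: gen_nat | apply: genM].
  by rewrite !sE /q ee; field.
have e0 : e ord0 = ord0.
  apply/esym/(@row_eq 1 (q ord0)) => [|j]; first exact: oner_neq0.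
  by rewrite -sE alpha_row0 (aut1 s_aut) mulr1.
have q_e0 : q ord0 = 1 by rewrite /q e0 divff.
have qN i i' : q i * q i' * (N (e i) (e i') ord0)%:R = (N i i' ord0)%:R.
  pose eta := perm e_inj.
  have eta0 : (eta^-1)%g ord0 = ord0 by rewrite -[in LHS]e0 -(permE e_inj) permK.
  pose u l := q i * q i' * (N (e i) (e i') l)%:R.
  pose v l := (N i i' ((eta^-1)%g l))%:R * q ((eta^-1)%g l).
  suff uv : u =1 v by have := uv ord0; rewrite /u /v eta0 q_e0 mulr1.
  apply: row_lin => j; rewrite /u /v.
  transitivity (s (alpha i j * alpha i' j)).
    rewrite (autM s_aut (Kalpha i j) (Kalpha i' j)) !sE [RHS]mulrACA alphaM mulr_sumr.
    by apply: eq_bigr => l _; rewrite -[LHS]mulrA.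
  rewrite alphaM (aut_sum s_aut) => [|l]; last first.
    by apply: genM; [exact: gen_nat|exact: Kalpha].
  rewrite [RHS](reindex_inj (@perm_inj _ eta)); apply: eq_bigr => l _.
  rewrite permK permE -mulrA -sE (autM s_aut) ?(aut_nat s_aut) //.
    exact: gen_nat.
  exact: Kalpha.
have d_e i : d (e i) = d i.
  have [i' Nii'] := N0_ex i; have [N1 dii'] := N0_one Nii'.
  have qq := qN i i'; rewrite N1 in qq.
  have Ne : N (e i) (e i') ord0 <> 0%N.
    by move=> Ne; move/eqP: qq; rewrite Ne mulr0 eq_sym oner_eq0.
  have [N1e dee'] := N0_one Ne; move/eqP: qq; rewrite N1e mulr1.
  rewrite /q -dii' -dee' -expr2 expr_div_n -!natrX => /eqP/divr1_eq/eqP.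
  by rewrite eqr_nat eqn_exp2r // => /eqP.
exists (perm e_inj) => i; rewrite permE; split=> // j.
by rewrite sE /q d_e divff ?mul1r.
Qed.

End CharacterTable.

(** * Class functions, central elements and the theorem *)

Lemma nth_ord_tuple (V : nmodType) n (b : 'I_n -> V) (i : 'I_n) :
  [tuple b i | i < n]`_i = b i.
Proof. by rewrite (nth_map i) ?size_enum_ord // nth_ord_enum. Qed.

Section CentralElements.
Variables (k : numClosedFieldType) (C : tensorCat k) (n : nat) (M : 'I_n -> C).
Hypotheses (C_fusion : is_fusion M) (C_integral : is_integral M).
Variable a : pivotal C.
Hypothesis a_canonical : is_canonical_spherical M a.
Variables (A : adjointAlg C) (iota : forall i, mor (M i \ox ldual (M i)) (adj A)).
Hypothesis A_decomp : is_biproduct iota (fun i => adj_proj A (M i)).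

Local Notation chi i := (int_char A a (M i)).
Let E i : CE A := iota i \c coev (M i).

Lemma qdimM_neq0 i : qdim a (M i) != 0.
Proof.
have [d d0 ->] := qdim_simple C_integral a_canonical (simpleM C_fusion i).
by rewrite pnatr_eq0 -lt0n.
Qed.

Definition central_char i (b : CE A) : k := pairing (chi i) b / qdim a (M i).

Lemma pairing_scalar (f : CF A) : scalar (pairing f).
Proof. by move=> c b b'; rewrite /pairing compDr /scal linearP. Qed.

Lemma central_char_scalar i : scalar (central_char i).
Proof. by move=> c b b'; rewrite /central_char pairing_scalar mulrDl mulrA. Qed.

(** The loop of [M i] with [b] acting on it is [<chi_i, b>], and also the scalar
    of the action times the dimension. *)
Lemma action_central_char i b : action (M i) b = central_char i b *: idm (M i).
Proof.
have [c ec] := fusion_schur C_fusion (action (M i) b) (simpleM C_fusion i).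
rewrite ec /central_char /pairing /int_char -compA adj_proj_action ec tenZm tenm1.
rewrite compZm comp1m compmZ /scal linearZ -/(scal _) -/(qdim a (M i)).
by rewrite /= mulfK ?qdimM_neq0.
Qed.

Lemma central_charM i b b' :
  central_char i (ce_mul b b') = central_char i b * central_char i b'.
Proof.
have := action_mul (M i) b b'; rewrite !action_central_char compZm compmZ comp1m.
rewrite scalerA => /eqP; rewrite -subr_eq0 -scalerBl scaler_eq0 subr_eq0.
by case/orP=> /eqP // id0; case: (simpleM C_fusion i).1.
Qed.

Lemma central_char1 i : central_char i (ce_one A) = 1.
Proof.
have := action_one A (M i); rewrite action_central_char => /eqP.
rewrite -subr_eq0 -[X in _ - X]scale1r -scalerBl scaler_eq0 subr_eq0.
by case/orP=> /eqP // id0; case: (simpleM C_fusion i).1.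
Qed.

Lemma adj_proj_central_char i (b : CE A) :
  adj_proj A (M i) \c b = central_char i b *: coev (M i).
Proof.
by rewrite adj_proj_action action_central_char tenZm tenm1 compZm comp1m.
Qed.

Lemma adj_proj_E i j : adj_proj A (M i) \c E j = (i == j)%:R *: coev (M i).
Proof.
case: A_decomp => pi pij _; rewrite /E compA.
case: eqVneq => [<-|ij]; first by rewrite pi scale1r comp1m.
by rewrite pij 1?eq_sym // comp0m scale0r.
Qed.

Lemma central_char_E i j : central_char i (E j) = (i == j)%:R.
Proof.
rewrite /central_char /pairing /int_char -compA adj_proj_E compmZ /scal linearZ.
by rewrite -/(scal _) -/(qdim a (M i)) /= mulfK ?qdimM_neq0.
Qed.

Lemma central_char_inj b b' : (forall i, central_char i b = central_char i b') -> b = b'.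
Proof.
case: A_decomp => _ _ ip bb'; rewrite -[b]comp1m -[b']comp1m -ip !comp_suml.
by apply: eq_bigr => i _; rewrite -[LHS]compA -[RHS]compA !adj_proj_central_char bb'.
Qed.

(** The restriction of a class function to the summand of index [i] is a multiple
    of the right evaluation, by duality and Schur's lemma. *)
Lemma chi_span (f : CF A) : exists x : 'I_n -> k, f = \sum_i x i *: chi i.
Proof.
case: A_decomp => _ _ ip.
have ex i : exists c, f \c iota i = c *: right_ev a (M i).
  by apply: right_ev_span => g; exact: (fusion_schur C_fusion g (simpleM C_fusion i)).
exists (fun i => sval (cid (ex i))).
rewrite -[LHS]compm1 -ip comp_sumr; apply: eq_bigr => i _.
by rewrite compA /int_char -compZm; case: (cid _) => c /= ->.
Qed.

Lemma pairing_chi_E i j : pairing (chi i) (E j) = (i == j)%:R * qdim a (M i).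
Proof. by rewrite -central_char_E /central_char divfK ?qdimM_neq0. Qed.

Lemma chi_free : free [tuple chi i | i < n].
Proof.
apply/freeP => x x0 i.
have := congr1 (fun f : CF A => pairing f (E i)) x0.
rewrite /pairing comp_suml comp0m /scal linear0 linear_sum (bigD1 i) //= big1.
  rewrite nth_ord_tuple compZm linearZ /= addr0.
  rewrite -/(scal _) -/(pairing _ _) pairing_chi_E eqxx mul1r => /eqP.
  by rewrite mulf_eq0 (negPf (qdimM_neq0 i)) orbF => /eqP.
move=> j /negPf ji.
rewrite nth_ord_tuple compZm linearZ /=.
by rewrite -/(scal _) -/(pairing _ _) pairing_chi_E ji mul0r mulr0.
Qed.

Lemma coord_chi i j : coord [tuple chi i | i < n] i (chi j) = (i == j)%:R.
Proof.
have := coord_free j i chi_free; rewrite nth_ord_tuple.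
by rewrite eq_sym.
Qed.

Lemma cf_mul_chi i j :
  cf_mul a M (chi i) (chi j) = \sum_l (fusion_coef M (M i) j l)%:R *: chi l.
Proof.
rewrite /cf_mul (bigD1 i) //= [X in _ + X]big1 ?addr0 => [|i' /negPf i'i].
  rewrite (bigD1 j) //= [X in _ + X]big1 ?addr0 => [|j' /negPf j'j].
    by apply: eq_bigr => l _; rewrite !coord_chi !eqxx !mul1r.
  by apply: big1 => l _; rewrite !coord_chi j'j mulr0 mul0r scale0r.
apply: big1 => j' _; apply: big1 => l _.
by rewrite coord_chi i'i !mul0r scale0r.
Qed.

End CentralElements.

Section Transport.
Variables (k : fieldType) (n : nat) (alpha : 'M[k]_n) (s : k -> k) (eta : 'S_n).
Hypothesis alpha_unit : alpha \in unitmx.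
Hypothesis s_row : forall i j, s (alpha i j) = alpha (eta i) j.

Lemma sigmaF_chi (V : vectType k) (chi F : 'I_n -> V) i :
  free [tuple chi i | i < n] -> (forall i, chi i = \sum_j alpha i j *: F j) ->
  sigmaF alpha s chi F (chi i) = chi (eta i).
Proof.
move=> chi_free chiF.
rewrite /sigmaF (bigD1 i) //= [X in _ + X]big1 ?addr0 => [|i' /negPf i'i].
  have := coord_free i i chi_free; rewrite nth_ord_tuple.
  move=> ->; rewrite eqxx scale1r chiF.
  by apply: eq_bigr => j _; rewrite s_row.
have := coord_free i i' chi_free; rewrite nth_ord_tuple.
by move=> ->; rewrite eq_sym i'i scale0r.
Qed.

(** Both sides are linear in [v], so it is enough to compare them on the
    normalised class sums, where they are [s (alpha i j) / d i]. *)
Lemma sigmaE_char (W : vectType k) (r : 'I_n -> W -> k) (d dcl : 'I_n -> k)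
    (cs : 'I_n -> W) i v :
  (forall i, scalar (r i)) ->
  (forall w w', (forall i, r i w = r i w') -> w = w') ->
  (forall i, d i != 0) -> (forall j, dcl j != 0) ->
  (forall i j, r i (cs j) = dcl j * alpha i j / d i) ->
  (forall i, d (eta i) = d i) ->
  (forall i j, s (alpha i j) = alpha i (tau alpha s j)) ->
  r i (sigmaE alpha s dcl cs v) = r (eta i) v.
Proof.
move=> r_lin r_inj d0 dcl0 r_cs d_eta tauE.
pose b j := (dcl j)^-1 *: cs j.
have r0 l : r l 0 = 0.
  by have := r_lin l (-1) 0 0; rewrite scaler0 addr0 mulN1r addNr.
have rZ l c w : r l (c *: w) = c * r l w.
  by rewrite -[c *: w]addr0 r_lin r0 addr0.
have r_sum l (x : 'I_n -> k) (w : 'I_n -> W) :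
    r l (\sum_j x j *: w j) = \sum_j x j * r l (w j).
  by elim/big_rec2: _ => [|j y z _ <-]; [exact: r0|rewrite r_lin].
have r_b l j : r l (b j) = alpha l j / d l.
  by rewrite rZ r_cs -mulrA mulKf.
have sumE (x : 'I_n -> k) l :
    \sum_j x j * r l (b j) = (alpha *m (\col_j x j)) l ord0 / d l.
  rewrite mxE mulr_suml; apply: eq_bigr => j _.
  by rewrite r_b mxE mulrA [x j * _]mulrC.
have b_free : free [tuple b j | j < n].
  apply/freeP => x; under eq_bigr do rewrite nth_ord_tuple; move=> x0 j.
  have : alpha *m (\col_j x j) = 0.
    apply/colP => l; have := congr1 (r l) x0; rewrite r_sum sumE r0 => /eqP.
    by rewrite mulf_eq0 invr_eq0 (negPf (d0 l)) orbF => /eqP ->; rewrite mxE.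
  move/(congr1 (mulmx (invmx alpha))); rewrite mulKmx // mulmx0.
  by move/colP/(_ j); rewrite !mxE.
have [x vE] : exists x : 'I_n -> k, v = \sum_j x j *: b j.
  exists (fun j => (invmx alpha *m (\col_l (d l * r l v))) j ord0).
  apply: r_inj => l; rewrite r_sum sumE.
  have -> : \col_j (invmx alpha *m \col_l (d l * r l v)) j ord0
      = invmx alpha *m \col_l (d l * r l v) by apply/colP => j; rewrite mxE.
  by rewrite mulKVmx // mxE mulrC mulKf.
have coordE j : coord [tuple b j | j < n] j v = x j.
  rewrite vE; have := coord_sum_free x j b_free.
  by under eq_bigr do rewrite nth_ord_tuple.
rewrite /sigmaE; under eq_bigr do rewrite coordE.
rewrite (r_sum _ x (fun j => b (tau alpha s j))) vE r_sum.
by apply: eq_bigr => j _; rewrite !r_b -tauE s_row d_eta.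
Qed.

End Transport.

Theorem theorem1 (R : realType) (C : tensorCat R[i]) (m : nat)
  (* an integral fusion category with commutative Grothendieck ring *)
  (M : 'I_m.+1 -> C) (M0 : M ord0 = tone C)
  (C_fusion : is_fusion M) (C_integral : is_integral M)
  (C_comm : Gr_commutative M)
  (a : pivotal C) (a_canonical : is_canonical_spherical M a)
  (* the adjoint algebra A = FR(1) and its decomposition *)
  (A : adjointAlg C)
  (iota : forall i, mor (M i \ox ldual (M i)) (adj A))
  (A_decomp : is_biproduct iota (fun i => adj_proj A (M i))) :
  let d i := qdim a (M i) in
  let chi i := int_char A a (M i) in
  let E i : CE A := iota i \c coev (M i) in
  forall
  (* the primitive idempotents and the characters of CF(C) *)
  (F : 'I_m.+1 -> CF A) (mu : 'I_m.+1 -> CF A -> R[i])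
  (F_inj : injective F)
  (F_prim : forall f : CF A,
     is_primitive_idempotent (cf_mul a M) f <-> exists j, f = F j)
  (mu_char : forall j, is_character (cf_mul a M) (chi ord0) (mu j))
  (mu_F : forall i j, mu i (F j) = (i == j)%:R)
  (mu0 : forall i, mu ord0 (chi i) = d i)
  (* the conjugacy classes *)
  (cl : 'I_m.+1 -> drinfeld_center C)
  (inc : forall j, mor (cl j) (radj A)) (prj : forall j, mor (radj A) (cl j))
  (cl_simple : forall j, is_simple (cl j))
  (cl_noniso : forall i j, isomorphic (cl i) (cl j) -> i = j)
  (cl_decomp : is_biproduct inc prj)
  (cl_F : forall j, CF_of_End (inc j \c prj j) = F j),
  let alpha : 'M[R[i]]_m.+1 := \matrix_(i, j) mu j (chi i) in
  let dcl j := qdim a (cobj (cl j)) in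
  forall
  (* the class sums and their structure constants *)
  (cs : 'I_m.+1 -> CE A)
  (cs_pairing : forall i j, pairing (chi i) (cs j) = dcl j * alpha i j)
  (c : 'I_m.+1 -> 'I_m.+1 -> 'I_m.+1 -> R[i])
  (c_struct : forall i j, ce_mul (cs i) (cs j) = \sum_k c i j k *: cs k)
  (c_rat : forall i j k, exists q : rat, c i j k = ratr q),
  let K := generated_field [set alpha i j | i in setT & j in setT] in
  forall sigma : R[i] -> R[i], is_field_aut K sigma ->
  is_algebra_endo (@ce_mul _ _ A) (ce_one A) (sigmaE alpha sigma dcl cs) /\
  exists eta : 'S_m.+1, forall i,
    sigmaF alpha sigma chi F (chi i) = chi (eta i) /\
    sigmaE alpha sigma dcl cs (E i) = E ((eta^-1)%g i).
Proof.
move=> d chi E F mu F_inj F_prim mu_char mu_F mu0 cl inc prj cl_simple cl_noniso.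
move=> cl_decomp cl_F alpha dcl cs cs_pairing c c_struct c_rat K sigma sigma_aut.
have dP i := qdim_simple C_integral a_canonical (simpleM C_fusion i).
have dclP j := qdim_nat C_fusion C_integral a_canonical
  (center_simple_neq0 (cl_simple j)).
pose dn i := s2val (cid2 (dP i)).
pose dcln j := s2val (cid2 (dclP j)).
have dn_gt0 i : (0 < dn i)%N by exact: (s2valP (cid2 (dP i))).
have dE i : d i = (dn i)%:R by exact: (s2valP' (cid2 (dP i))).
have dcln_gt0 j : (0 < dcln j)%N by exact: (s2valP (cid2 (dclP j))).
have dclE j : dcl j = (dcln j)%:R by exact: (s2valP' (cid2 (dclP j))).
have d_neq0 i : d i != 0 by exact: (qdimM_neq0 C_fusion C_integral a_canonical).
have dcl_neq0 j : dcl j != 0 by rewrite dclE pnatr_eq0 -lt0n.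
have mu_sum j (x : 'I_m.+1 -> R[i]) (f : 'I_m.+1 -> CF A) :
    mu j (\sum_i x i *: f i) = \sum_i x i * mu j (f i).
  have [mu_lin _ _] := mu_char j; elim/big_rec2: _ => [|i y z _ <-]; last exact: mu_lin.
  by have := mu_lin (-1) 0 0; rewrite scaler0 addr0 mulN1r addNr.
(* Expanding [F] in the [chi] inverts [alpha], which thus is a square matrix of
   full rank. *)
have chi_F := chi_span C_fusion a A_decomp (F _).
pose X : 'M[R[i]]_m.+1 := \matrix_(l, i) sval (cid (chi_F l)) i.
have FE l : F l = \sum_i X l i *: chi i.
  rewrite [LHS](svalP (cid (chi_F l))).
  by apply: eq_bigr => i _; rewrite mxE.
have Xalpha : X *m alpha = 1%:M.
  apply/matrixP => l j; rewrite !mxE eq_sym -mu_F FE mu_sum.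
  by apply: eq_bigr => i _; rewrite [alpha _ _]mxE.
have [_ alpha_unit] := mulmx1_unit Xalpha.
have chiE i : chi i = \sum_j alpha i j *: F j.
  transitivity (\sum_l (alpha *m X) i l *: chi l).
    rewrite (mulmx1C Xalpha) (bigD1 i) //= [X in _ + X]big1 => [|l /negPf li].
      by rewrite mxE eqxx scale1r addr0.
    by rewrite mxE eq_sym li scale0r.
  under [RHS]eq_bigr do rewrite FE scaler_sumr.
  rewrite exchange_big /=; apply: eq_bigr => l _; rewrite mxE scaler_suml.
  by apply: eq_bigr => j _; rewrite scalerA.
pose N i i' l := fusion_coef M (M i) i' l.
have alphaM i i' j : alpha i j * alpha i' j = \sum_l (N i i' l)%:R * alpha l j.
  have [_ _ muM] := mu_char j.
  rewrite !mxE -muM (cf_mul_chi C_fusion C_integral a_canonical A_decomp) mu_sum.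
  by apply: eq_bigr => l _; rewrite mxE.
have alpha_col0 i : alpha i ord0 = (dn i)%:R by rewrite mxE mu0 dE.
have alpha_row0 j : alpha ord0 j = 1 by rewrite mxE; case: (mu_char j).
pose r := central_char M a (A := A).
have r_cs i j : r i (cs j) = dcl j * alpha i j / d i.
  by rewrite /r /central_char cs_pairing.
have r_lin i : scalar (r i) by exact: central_char_scalar.
have r_inj b b' : (forall i, r i b = r i b') -> b = b'.
  exact: (central_char_inj C_fusion C_integral a_canonical A_decomp).
have rM i b b' : r i (ce_mul b b') = r i b * r i b'.
  exact: (central_charM C_fusion C_integral a_canonical).
have r_sum i (x : 'I_m.+1 -> R[i]) (f : 'I_m.+1 -> CE A) :
    r i (\sum_j x j *: f j) = \sum_j x j * r i (f j).
  elim/big_rec2: _ => [|j y z _ <-]; last exact: r_lin.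
  by have := r_lin i (-1) 0 0; rewrite scaler0 addr0 mulN1r addNr.
have omegaM i j l :
    (dcln j)%:R * alpha i j / (dn i)%:R * ((dcln l)%:R * alpha i l / (dn i)%:R)
    = \sum_p c j l p * ((dcln p)%:R * alpha i p / (dn i)%:R).
  rewrite -dE -!dclE -!r_cs -rM c_struct r_sum.
  by apply: eq_bigr => p _; rewrite r_cs dclE.
have N0_one i i' : N i i' ord0 <> 0%N -> N i i' ord0 = 1%N /\ dn i = dn i'.
  rewrite /N /fusion_coef M0 => N0.
  have [N1 iso] :=
    unit_multiplicity C_fusion (simpleM C_fusion i) (simpleM C_fusion i') N0.
  split=> //; apply/eqP; rewrite -(eqr_nat R[i]) -!dE; apply/eqP.
  by rewrite /d a_canonical.1 (qdim_iso a iso).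
have N0_ex i : exists i', N i i' ord0 <> 0%N.
  rewrite /N /fusion_coef M0.
  exact: (unit_multiplicity_ex C_fusion (simpleM C_fusion i)).
have [eta etaP] := galois_row_perm sigma_aut alpha_unit dn_gt0 alpha_col0 alpha_row0
  alphaM dcln_gt0 c_rat omegaM N0_one N0_ex.
have d_eta i : d (eta i) = d i by rewrite !dE (etaP i).1.
have s_row i j : sigma (alpha i j) = alpha (eta i) j by exact: (etaP i).2.
have tauE := tauP sigma_aut alpha_unit alpha_row0 alphaM.
have r_sigmaE i v : r i (sigmaE alpha sigma dcl cs v) = r (eta i) v.
  exact: sigmaE_char.
split; [split|exists eta => i; split].
- by move=> x u v; apply: r_inj => i; rewrite r_sigmaE !r_lin !r_sigmaE.
- apply: r_inj => i; rewrite r_sigmaE.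
  by rewrite /r !(central_char1 C_fusion C_integral a_canonical).
- by move=> u v; apply: r_inj => i; rewrite r_sigmaE !rM !r_sigmaE.
- apply: sigmaF_chi => //.
  exact: (chi_free C_fusion C_integral a_canonical A_decomp).
apply: r_inj => l; rewrite r_sigmaE.
rewrite /r /E !(central_char_E C_fusion C_integral a_canonical A_decomp).
by congr (_%:R); rewrite -(inj_eq (@perm_inj _ eta) l) permKV.
Qed.
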